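(* The symmetric measure is the unique fully supported $T$-invariant ergodic Borel probability measure for the Euler adic system $(X,T)$. In particular, if $\mu$ is a fully supported $T$-invariant ergodic Borel probability measure on $X$ and $C$ is a cylinder set of length $n$, then $\mu(C)=\dfrac{1}{(n+1)!}$.
   Context: The Euler graph is the infinite directed multigraph with vertex set $\{(i,j): i,j\in\mathbb{Z}_{\ge 0}\}$, having exactly $j+1$ edges from $(i,j)$ to $(i+1,j)$ and exactly $i+1$ edges from $(i,j)$ to $(i,j+1)$, and no other edges. The level of $(i,j)$ is $i+j$; the root is $R=(0,0)$. For each vertex, the (finite) set of edges entering it is given a fixed total order. $X$ is the set of infinite (edge) paths starting at $R$, a compact metric space in which two paths agreeing on exactly the first $n$ levels are at distance $2^{-n}$. A cylinder set of length $n$ is the set of all paths in $X$ with a specified initial segment consisting of $n$ edges. Two paths $x,y\in X$ are comparable if they coincide after some level; in that case $x<y$ if, at the last level where their edges differ, the edge of $x$ is smaller than the edge of $y$ (both enter the same vertex). $X_{\max}$ and $X_{\min}$ are the sets of maximal and minimal paths for this partial order. The adic transformation $T:X\setminus X_{\max}\to X\setminus X_{\min}$ sends $x$ to the smallest $y$ with $y>x$; it is a bijection, continuous with continuous inverse. A Borel probability measure $\mu$ on $X$ is $T$-invariant if $\mu(TB)=\mu(B)$ for every Borel $B\subset X\setminus X_{\max}$; it is ergodic if every Borel set that is invariant under $T$ has measure $0$ or $1$; it is fully supported if every nonempty open set has positive measure. The symmetric measure is the Borel probability measure on $X$ that assigns equal measure to all cylinder sets of the same length. *)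

(* Defs.v *)
From HB Require Import structures.
From mathcomp Require Import all_boot all_order all_algebra.
From mathcomp Require Import all_classical all_reals all_analysis.
Set Implicit Arguments.
Unset Strict Implicit.
Unset Printing Implicit Defensive.
Import Order.TTheory GRing.Theory Num.Theory.
Local Open Scope classical_set_scope.
Local Open Scope ring_scope.

Definition vertex : Type := (nat * nat)%type.

Definition root : vertex := (0%N, 0%N).

(* [Tagged _ (inl k)] at v = (i, j) is the k-th of the j + 1 edges from (i, j)
   to (i + 1, j), and [Tagged _ (inr k)] is the k-th of the i + 1 edges from
   (i, j) to (i, j + 1). *)
Definition edge : Type := {v : vertex & ('I_v.2.+1 + 'I_v.1.+1)%type}.

Definition source (e : edge) : vertex := tag e.

Definition target (e : edge) : vertex :=
  match tagged e with
  | inl _ => ((source e).1.+1, (source e).2)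
  | inr _ => ((source e).1, (source e).2.+1)
  end.

Definition entering (v : vertex) : pred edge := [pred e | target e == v].

(* Only the restrictions of [le] to the sets [entering v] are meaningful:
   edges with distinct targets are never compared. *)
Definition edge_order (le : rel edge) : Prop :=
  forall v : vertex,
    [/\ {in entering v, reflexive le},
        {in entering v &, antisymmetric le},
        {in entering v & &, transitive le} &
        {in entering v &, total le}].

Definition segment (s : seq edge) : bool :=
  if s is e :: s' then
    (source e == root) && path (fun e1 e2 => target e1 == source e2) e s'
  else true.

(* The parameter [R] only serves as the codomain of the distance on paths. *)
Record path_space (R : realType) := PathSpace {
  path_edge :> nat -> edge;
  path_root : source (path_edge 0) = root;
  path_adj : forall n, target (path_edge n) = source (path_edge n.+1)
}.

HB.instance Definition _ (R : realType) := gen_eqMixin (path_space R).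
HB.instance Definition _ (R : realType) := gen_choiceMixin (path_space R).

Section path_structures.
Variable R : realType.
Implicit Types x y z : path_space R.

Lemma path_space_eq x y : (forall n, x n = y n) -> x = y.
Proof.
case: x y => [f f0 fS] [g g0 gS] /= /funext fg; subst g.
by congr PathSpace; exact: Prop_irrelevance.
Qed.

Definition axis_edge (n : nat) : edge :=
  Tagged (fun v : vertex => ('I_v.2.+1 + 'I_v.1.+1)%type)
    (inl ord0 : ('I_(n, 0%N).2.+1 + 'I_(n, 0%N).1.+1)%type).

Definition axis_path : path_space R :=
  @PathSpace R axis_edge erefl (fun=> erefl).

HB.instance Definition _ := isPointed.Build (path_space R) axis_path.

(* The first index at which x and y differ is the number of levels on which
   they agree. *)
Definition path_dist x y : R :=
  if pselect (exists n, x n != y n) is left xy then 2 ^- ex_minn xy else 0.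

Lemma path_dist_ltP x y n :
  reflect (forall i, (i <= n)%N -> x i = y i) (path_dist x y < 2 ^- n).
Proof.
rewrite /path_dist; case: pselect => [xy|xy]; last first.
  rewrite invr_gt0 exprn_gt0//; apply: ReflectT => i _.
  by apply/eqP/negPn/negP => xyi; apply: xy; exists i.
case: ex_minnP => m xym mmin.
rewrite ltf_pV2 ?posrE ?exprn_gt0// ltr_eXn2l ?ltr1n//.
apply: (iffP idP) => [nm i ilen|H].
  apply/eqP/negPn/negP => /mmin; apply/negP.
  by rewrite -ltnNge (leq_ltn_trans ilen).
by rewrite ltnNge; apply/negP => /H /eqP; exact/negP.
Qed.

Lemma path_distxx x : path_dist x x = 0.
Proof.
by rewrite /path_dist; case: pselect => // xx; exfalso; case: xx => n /eqP.
Qed.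

Lemma path_dist_ge0 x y : 0 <= path_dist x y.
Proof.
by rewrite /path_dist; case: pselect => // xy; rewrite invr_ge0 exprn_ge0.
Qed.

Lemma path_dist_positivity x y : path_dist x y = 0 -> x = y.
Proof.
rewrite /path_dist; case: pselect => [xy /eqP|xy _].
  by rewrite invr_eq0 expf_eq0 pnatr_eq0 andbF.
apply: path_space_eq => n.
by apply/eqP/negPn/negP => xyn; apply: xy; exists n.
Qed.

Lemma path_dist_sym x y : path_dist x y = path_dist y x.
Proof.
rewrite /path_dist; case: pselect => [xy|xy]; case: pselect => [yx|yx] //.
- by congr (2 ^- _); apply: eq_ex_minn => n /=; rewrite eq_sym.
- by case: yx; case: xy => n; rewrite eq_sym; exists n.
- by case: xy; case: yx => n; rewrite eq_sym; exists n.
Qed.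

Lemma path_dist_triangle y x z :
  path_dist x z <= path_dist x y + path_dist y z.
Proof.
rewrite {1}/path_dist; case: pselect => [xz|_]; last first.
  by rewrite addr_ge0 ?path_dist_ge0.
case: ex_minnP => m xzm _.
have [/path_dist_ltP xy|xy] := ltP (path_dist x y) (2 ^- m); last first.
  by rewrite (le_trans xy)// lerDl path_dist_ge0.
have [/path_dist_ltP yz|yz] := ltP (path_dist y z) (2 ^- m); last first.
  by rewrite (le_trans yz)// lerDr path_dist_ge0.
by move: xzm; rewrite xy// yz// eqxx.
Qed.

HB.instance Definition _ := @isMetric.Build R (path_space R) path_dist
  path_distxx path_dist_positivity path_dist_sym path_dist_triangle.

(* The measurable sets are the Borel sets. *)
HB.instance Definition _ := Measurable.copy (path_space R)
  (g_sigma_algebraType (@open (path_space R))).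

End path_structures.

Section adic.
Variables (R : realType) (le : rel edge).
Implicit Types (x y : path_space R) (B : set (path_space R)).

Definition cylinder (s : seq edge) : set (path_space R) :=
  [set x | mkseq x (size s) = s].

Definition is_cylinder (n : nat) (C : set (path_space R)) : Prop :=
  exists s : seq edge, [/\ segment s, size s = n & C = cylinder s].

(* Edges following a last difference coincide, so that [x n] and [y n] below
   have the same target. *)
Definition path_lt x y : Prop :=
  exists n, [/\ forall m, (n < m)%N -> x m = y m, x n != y n & le (x n) (y n)].

Definition Xmax : set (path_space R) := [set x | forall y, ~ path_lt x y].

Definition Xmin : set (path_space R) := [set x | forall y, ~ path_lt y x].

(* The value on [Xmax], where the adic transformation is undefined, is arbitrary. *)
Definition adic x : path_space R :=
  xget x [set y | path_lt x y /\ forall z, path_lt x z -> z = y \/ path_lt y z].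

Definition adic_invariant_measure (mu : probability (path_space R) R) : Prop :=
  forall B, measurable B -> B `<=` ~` Xmax -> mu (adic @` B) = mu B.

(* T B = B, for the partially defined bijection T : ~` Xmax -> ~` Xmin. *)
Definition adic_invariant_set B : Prop :=
  adic @` (B `\` Xmax) = B `\` Xmin.

Definition ergodic (mu : probability (path_space R) R) : Prop :=
  forall B, measurable B -> adic_invariant_set B ->
    mu B = 0%E \/ mu B = 1%E.

Definition fully_supported (mu : probability (path_space R) R) : Prop :=
  forall U : set (path_space R), open U -> U !=set0 -> (0 < mu U)%E.

Definition symmetric_measure (mu : probability (path_space R) R) : Prop :=
  forall n C D, is_cylinder n C -> is_cylinder n D -> mu C = mu D.

(* A measure is unspecified on nonmeasurable sets, hence is compared only on
   measurable ones. *)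
Definition same_measure (mu nu : probability (path_space R) R) : Prop :=
  forall B, measurable B -> mu B = nu B.

End adic.

(* Main.v *)
From HB Require Import structures.
Require Import Defs.
From mathcomp Require Import all_boot all_order all_algebra.
From mathcomp Require Import all_classical all_reals all_analysis.
From mathcomp Require Import measurable_realfun zify ring lra.
Import Order.TTheory GRing.Theory Num.Theory numFieldNormedType.Exports.
Local Open Scope classical_set_scope.
Local Open Scope ring_scope.
Set Implicit Arguments.
Unset Strict Implicit.
Unset Printing Implicit Defensive.

(** Call a measure on the path space central if two cylinders have the same mass
    whenever their initial segments end at the same vertex.  On the cylinder of
    a segment that has a successor among the segments with the same endpoint,
    the adic transformation replaces the segment by its immediate successor
    ([adic_immediate]), and successors connect all the segments with a given
    endpoint ([comparable_ind]).  Hence invariance and centrality are the same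
    ([invariant_central], [central_invariant]), and an invariant measure is a
    nonnegative weight p on the vertices satisfying
    p(a, b) = (b + 1) p(a + 1, b) + (a + 1) p(a, b + 1).

    The crux is an inequality between path counts.  The number of paths to
    w = (i, j) from (a + 1, b) is at least (i - a) / (i + b + 2) times the number
    of those from (a, b + 1) ([path_count_balance]), and exchanging the
    coordinates bounds the same ratio from above.  Both bounds tend to 1 when i
    and j are large.  Since p at a vertex is the sum of the path counts from that
    vertex to the vertices w of a later level, weighted by p(w), any two adjacent
    vertices of a level have the same weight, provided that the mass of the
    vertices w with bounded first or second coordinate tends to 0 with the level.
    Then p(a, b) = p(0, 0) / (a + b + 1)! ([harmonic_uniform],
    [central_uniform]).

    This proviso holds for a fully supported ergodic measure: the paths along
    which a coordinate stays below K for ever form an invariant set that misses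
    a nonempty open set, hence a null set ([ergodic_avoids_axes]).  So such a
    measure is the symmetric one.  The proviso also holds for the symmetric
    measure eta, because the number of paths to (i, j) grows only exponentially
    in j when i is fixed ([path_count_bound], [symmetric_avoids_axes]).
    Ergodicity of eta then comes from the same argument: if B is invariant, the
    restriction of eta to B is central, so that B is independent of every
    cylinder, hence of itself ([symmetric_ergodic]).  The measure eta exists as
    the image of Lebesgue measure on [0, 1) under the factorial-base expansion
    ([exists_symmetric_measure]). *)

(** * Counting paths between two vertices *)

(** The number of paths of k edges from (a, b) to w. *)
Fixpoint path_count (w : vertex) (k a b : nat) : nat :=
  if k is k'.+1
  then (b.+1 * path_count w k' a.+1 b + a.+1 * path_count w k' a b.+1)%N
  else ((a, b) == w).

Lemma path_count_sym i j k a b :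
  path_count (i, j) k a b = path_count (j, i) k b a.
Proof.
elim: k a b => [|k IH] a b /=; first by rewrite !xpair_eqE andbC.
by rewrite !IH addnC.
Qed.

(** The induction on the number of edges is exact: write x, y, z for the counts
    from (a + 2, b), (a + 1, b + 1) and (a, b + 2).  Adding b + 1 times the
    inequality between x and y to a + 1 times the one between y and z, the
    coefficients of y match those of the claim with no loss. When w.1 <= a the
    truncated difference makes the claim trivial. *)
Lemma path_count_balance w k a b :
  ((w.1 - a) * path_count w k a b.+1 <=
   (w.1 + b + 2) * path_count w k a.+1 b)%N.
Proof.
case: w => i j /=; elim: k a b => [|k IH] a b /=.
  rewrite !xpair_eqE; case: eqVneq => [->|_]; first by rewrite subnn.
  by rewrite muln0.
have [ai|ia] := ltnP a i; last by move: ia; rewrite -subn_eq0 => /eqP ->.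
have := IH a.+1 b; have := IH a b.+1.
move: (path_count _ k a.+2 b) (path_count _ k a.+1 b.+1) (path_count _ k a b.+2).
move=> x y z; rewrite -(subnKC ai); move: (i - a.+1)%N => c.
have -> : (a.+1 + c - a = c.+1)%N by lia.
have -> : (a.+1 + c - a.+1 = c)%N by lia.
move=> /(leq_mul (leqnn a.+1)) yz /(leq_mul (leqnn b.+1)) xy.
lia.
Qed.

(** From the root, one can first walk to (a, b). *)
Lemma path_count_le_root w k a b :
  (path_count w k a b <= path_count w (a + b + k) 0 0)%N.
Proof.
elim: a b k => [|a IHa] b k.
  elim: b k => [|b IHb] k; first by rewrite !add0n.
  rewrite add0n addSnnS (leq_trans _ (IHb k.+1))//= mul1n.
  exact: leq_addl.
have -> : (a.+1 + b + k = a + b + k.+1)%N by lia.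
by apply: leq_trans (IHa b k.+1); rewrite /= mulSn -addnA leq_addr.
Qed.

Lemma path_count_past i j k a b : (i < a)%N -> path_count (i, j) k a b = 0%N.
Proof.
elim: k a b => [|k IH] a b ia /=; first by rewrite xpair_eqE gtn_eqF.
by rewrite !IH ?muln0// ltnW.
Qed.

(** The right-hand side solves the recursion of [path_count] with equality, by
    Pascal's rule and the absorption identity for binomial coefficients. *)
Lemma path_count_bound i j k a b : (a <= i)%N ->
  (path_count (i, j) k a b <= 'C(i + b + 1, i - a) * i.+1 ^ k)%N.
Proof.
elim: k a b => [|k IH] a b ai /=.
  rewrite muln1 !xpair_eqE; case: eqP => //= ->.
  by rewrite subnn bin0 leq_b1.
have [eai|neai] := eqVneq a i.
  subst a; rewrite subnn bin0 mul1n path_count_past// muln0 add0n.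
  have := IH i b.+1 (leqnn i); rewrite subnn bin0 mul1n expnS.
  exact: leq_mul.
have {}ai : (a < i)%N by rewrite ltn_neqAle neai ai.
have := IH a.+1 b ai; have := IH a b.+1 (ltnW ai).
move: (path_count _ _ _ _) (path_count _ _ _ _) => y x.
move: ai => /subnKC <-; move: (i - a.+1)%N => c {i neai IH}.
have -> : (a.+1 + c - a = c.+1)%N by lia.
have -> : (a.+1 + c - a.+1 = c)%N by lia.
have -> : (a.+1 + c + b.+1 + 1 = (a + b + c + 2).+1)%N by lia.
have -> : (a.+1 + c + b + 1 = a + b + c + 2)%N by lia.
rewrite binS expnS.
have := mul_bin_left (a + b + c + 2) c.
rewrite (_ : a + b + c + 2 - c = a + b + 2)%N; last by lia.
move: 'C(_, _) 'C(_, _) (_ ^ k)%N => u v m uv xm ym.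
apply: leq_trans (leq_add (leq_mul (leqnn _) ym) (leq_mul (leqnn _) xm)) _.
have -> : (b.+1 * (u * m) + a.+1 * ((v + u) * m) =
  ((a + b + 2) * u + a.+1 * v) * m)%N by lia.
by rewrite -uv; lia.
Qed.

(** * Weights on the vertices with vanishing mass near the axes *)

Section harmonic.
Variable R : realType.
Implicit Types p : nat -> nat -> R.

(** The relation between the masses of a cylinder and of its one-edge extensions,
    for a measure that only depends on the endpoint of the cylinder. *)
Definition harmonic p :=
  forall a b, p a b = b.+1%:R * p a.+1 b + a.+1%:R * p a b.+1.

Lemma harmonic_sym p : harmonic p -> harmonic (fun a b => p b a).
Proof. by move=> hp a b; rewrite hp addrC. Qed.

Lemma harmonic_expansion p k a b : harmonic p ->
  p a b = \sum_(i < (a + b + k).+1)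
    (path_count (val i, a + b + k - i)%N k a b)%:R * p i (a + b + k - i)%N.
Proof.
move=> hp; elim: k a b => [|k IH] a b /=.
  have ab : (a < (a + b + 0).+1)%N by lia.
  rewrite (bigD1 (Ordinal ab))//= big1 ?addr0.
    by rewrite addn0 addKn eqxx mul1r.
  move=> i; rewrite -val_eqE/= => ia.
  by rewrite xpair_eqE eq_sym (negbTE ia) mul0r.
rewrite hp (IH a.+1 b) (IH a b.+1).
have -> : (a.+1 + b + k = a + b + k.+1)%N by lia.
have -> : (a + b.+1 + k = a + b + k.+1)%N by lia.
rewrite !mulr_sumr -big_split/=; apply: eq_bigr => i _.
by rewrite natrD !natrM; ring.
Qed.

(** Expand both weights over the vertices (i, n - i) of a later level n.  For
    i >= K the two path counts are close by [path_count_balance]; for i < K the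
    count is bounded by the one from the root, so that these terms contribute
    at most the mass of the strip i < K. *)
Lemma harmonic_step p K k a b : harmonic p -> (forall i j, 0 <= p i j) ->
  (a <= K)%N -> (K <= a + b.+1 + k)%N ->
  K%:R * (p a b.+1 - p a.+1 b) <= (a + b + 2)%:R * p a b.+1 +
   K%:R * \sum_(i < K) (path_count (val i, a + b.+1 + k - i)%N (a + b.+1 + k) 0 0)%:R
     * p i (a + b.+1 + k - i)%N.
Proof.
move=> hp p0 aK Kn.
rewrite mulrBr lerBlDr; set n := (a + b.+1 + k)%N.
have eb : p a.+1 b = \sum_(i < n.+1)
    (path_count (val i, n - i)%N k a.+1 b)%:R * p i (n - i)%N.
  by rewrite (harmonic_expansion k a.+1 b hp) /n addSnnS.
have ea : p a b.+1 = \sum_(i < n.+1)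
    (path_count (val i, n - i)%N k a b.+1)%:R * p i (n - i)%N.
  by rewrite (harmonic_expansion k a b.+1 hp).
rewrite {}eb ![in leLHS]ea ![in leRHS]ea.
pose f i : R := (path_count (i, n - i)%N k a b.+1)%:R * p i (n - i)%N.
pose g i : R := (path_count (i, n - i)%N k a.+1 b)%:R * p i (n - i)%N.
pose q i : R := (path_count (i, n - i)%N n 0 0)%:R * p i (n - i)%N.
rewrite -[X in K%:R * X <= _]/(\sum_(i < n.+1) f i).
rewrite -[X in _ * X + _ + _]/(\sum_(i < n.+1) f i).
rewrite -[X in _ + _ * X + _]/(\sum_(i < K) q i).
rewrite -[X in _ <= _ + _ * X]/(\sum_(i < n.+1) g i).
have -> : \sum_(i < K) q i = \sum_(i < n.+1 | (i < K)%N) q i.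
  by rewrite (big_ord_widen n.+1)// ltnW.
rewrite (big_mkcond (fun i : 'I_n.+1 => (i < K)%N)) !mulr_sumr -!big_split/=.
apply: ler_sum => i _.
have pi0 := p0 i (n - i)%N.
(* In the strip, the term of f alone is bounded by that of q. *)
case: ltnP => iK.
  have : f i <= q i.
    by rewrite ler_wpM2r// ler_nat; exact: path_count_le_root.
  have : 0 <= g i by rewrite mulr_ge0.
  have : 0 <= f i by rewrite mulr_ge0.
  move: (f i) (g i) (q i) => F G Q F0 G0 FQ.
  have K0 : 0 <= K%:R :> R by [].
  have c0 : 0 <= (a + b + 2)%:R :> R by [].
  nra.
rewrite mulr0 addr0 /f /g !mulrA -mulrDl ler_wpM2r// -!natrM -natrD ler_nat.
have := path_count_balance (val i, (n - i)%N) k a b.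
move: (path_count _ _ _ _) (path_count _ _ _ _) => x y /= {ea f g q Kn}.
move: iK aK => /subnKC <- /subnKC <-.
rewrite -addnA addKn.
move: (K - a)%N (i - _)%N => u v H.
(* With K = a + u and i = K + v, [H] reads (u + v) y <= (a + u + v + b + 2) x.
   If x < y, then u (y - x) <= (a + b + 2) x, whence
   K (y - x) <= a y + (b + 2) x <= (a + b + 2) y. *)
have [yx|xy] := leqP y x; nia.
Qed.

(** In [harmonic_step] let the level tend to infinity, then K. *)
Lemma harmonic_le p a b : harmonic p -> (forall i j, 0 <= p i j) ->
  (forall i, (path_count (i, j) (i + j) 0 0)%:R * p i j @[j --> \oo] --> (0 : R)) ->
  p a b.+1 <= p a.+1 b.
Proof.
move=> hp p0 plim.
have key K : (a <= K)%N ->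
    K%:R * (p a b.+1 - p a.+1 b) <= (a + b + 2)%:R * p a b.+1.
  move=> aK; rewrite -[leRHS]addr0 -[in leRHS](mulr0 K%:R).
  pose S n : R := \sum_(i < K)
    (path_count (val i, n - i)%N n 0 0)%:R * p i (n - i)%N.
  have S0 : S n @[n --> \oo] --> (0 : R).
    have <- : \sum_(i < K) (0 : R) = 0 by rewrite big1.
    apply: cvg_big => [|i _]; first exact: add_continuous.
    rewrite -(cvg_shiftn i).
    apply: cvg_trans (plim i); apply: near_eq_cvg; near=> j.
    by rewrite /= addnK addnC.
  have S1 : (a + b + 2)%:R * p a b.+1 + K%:R * S n @[n --> \oo] -->
      (a + b + 2)%:R * p a b.+1 + K%:R * (0 : R).
    by apply: cvgD; [exact: cvg_cst|apply: cvgMr].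
  rewrite -(cvg_lim _ S1)//; apply: limr_ge; first by apply/cvg_ex; eexists; exact: S1.
  near=> n.
  have Kn : (K + a + b.+1 <= n)%N by near: n; exact: nbhs_infty_ge.
  have -> : n = (a + b.+1 + (n - (a + b.+1)))%N by lia.
  by apply: harmonic_step => //; lia.
rewrite leNgt; apply/negP => lt_p.
have d0 : 0 < p a b.+1 - p a.+1 b by rewrite subr_gt0.
(* With M above the ratio of the bound in [key] to the positive gap, [key] fails
   at K = a + M. *)
have := archi_boundP (divr_ge0 (mulr_ge0 (ler0n R (a + b + 2)) (p0 a b.+1)) (ltW d0)).
set M := Num.bound _; rewrite ltr_pdivrMr// => H.
have := key (a + M)%N (leq_addr _ _); rewrite leNgt => /negP; apply.
by apply: lt_le_trans H _; rewrite ler_pM2r// ler_nat leq_addl.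
Unshelve. all: by end_near. Qed.

(** The inequality of [harmonic_le], applied to p and to its transpose, makes p
    constant on levels; the harmonic relation then divides it by n + 2 from
    level n to the next. *)
Lemma harmonic_uniform p : harmonic p -> (forall i j, 0 <= p i j) ->
  (forall i, (path_count (i, j) (i + j) 0 0)%:R * p i j @[j --> \oo] --> (0 : R)) ->
  (forall j, (path_count (i, j) (i + j) 0 0)%:R * p i j @[i --> \oo] --> (0 : R)) ->
  forall a b, p a b = (a + b).+1`!%:R^-1 * p 0 0.
Proof.
move=> hp p0 lim1 lim2.
have eqp a b : p a b.+1 = p a.+1 b.
  apply/eqP; rewrite eq_le harmonic_le//=.
  apply: (@harmonic_le (fun a b => p b a)) => //; first exact: harmonic_sym.
  by move=> i; under eq_fun do rewrite path_count_sym addnC; exact: lim2.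
have lvl a b : p a b = p 0 (a + b)%N.
  by elim: a b => [//|a IH] b; rewrite -eqp IH addnS.
have p0n n : p 0 n = n.+1`!%:R^-1 * p 0 0.
  elim: n => [|n IH]; first by rewrite invr1 mul1r.
  have := hp 0 n; rewrite (lvl 1%N) add1n mul1r -{2}[p 0 n.+1]mul1r -mulrDl -natr1.
  rewrite natr1 natr1 IH => /esym/(canRL (mulKf _)) ->; last by rewrite pnatr_eq0.
  by rewrite mulrA [in RHS]factS natrM invfM.
by move=> a b; rewrite lvl p0n.
Qed.

(** An exponential over a factorial; the shift by i + 1 reduces the bound to a
    term of the exponential series. *)
Lemma path_count_negligible i :
  (path_count (i, j) (i + j) 0 0)%:R / (i + j).+1`!%:R @[j --> \oo] --> (0 : R).
Proof.
have H := @cvg_exp_coeff R i.+1%:R.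
apply: (@squeeze_cvgr _ _ _ _ (fun=> 0)
  (fun j => exp_coeff i.+1%:R (j + i.+1)%N)).
- near=> j; rewrite divr_ge0//= /exp_coeff/=.
  rewrite (_ : (j + i.+1 = (i + j).+1)%N); last by lia.
  rewrite ler_wpM2r ?invr_ge0// -natrX ler_nat.
  have := @path_count_bound i j (i + j) 0 0 (leq0n i).
  by rewrite addn0 subn0 addn1 binSn expnS.
- exact: cvg_cst.
- by rewrite cvg_shiftn.
Unshelve. all: by end_near. Qed.

End harmonic.

(** * Initial segments and the order on comparable sequences of edges *)

(** [segment] with an arbitrary starting vertex, which makes concatenations
    tractable. *)
Fixpoint chain (v : vertex) (s : seq edge) : bool :=
  if s is e :: s' then (source e == v) && chain (target e) s' else true.

Definition endpoint (s : seq edge) : vertex := last Defs.root (map target s).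

Lemma chain_cat v s t :
  chain v (s ++ t) = chain v s && chain (last v (map target s)) t.
Proof. by elim: s v => //= e s IH v; rewrite IH andbA. Qed.

Lemma segment_chain s : segment s = chain Defs.root s.
Proof.
case: s => //= e s; congr (_ && _).
by elim: s e => //= e' s IH e; rewrite IH eq_sym.
Qed.

Lemma segment_cat s t : segment (s ++ t) = segment s && chain (endpoint s) t.
Proof. by rewrite !segment_chain chain_cat. Qed.

Lemma endpoint_cat s t : endpoint (s ++ t) = last (endpoint s) (map target t).
Proof. by rewrite /endpoint map_cat last_cat. Qed.

Lemma segment_rcons s e :
  segment (rcons s e) = segment s && (source e == endpoint s).
Proof. by rewrite -cats1 segment_cat /= andbT. Qed.

Lemma endpoint_rcons s e : endpoint (rcons s e) = target e.
Proof. by rewrite /endpoint map_rcons last_rcons. Qed.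

Lemma target_level e :
  ((target e).1 + (target e).2)%N = ((source e).1 + (source e).2).+1.
Proof. by case: e => v [u|u]; rewrite /target /source /=; lia. Qed.

Lemma endpoint_level s : segment s ->
  ((endpoint s).1 + (endpoint s).2)%N = size s.
Proof.
elim/last_ind: s => // s e IH; rewrite segment_rcons => /andP[/IH {}IH /eqP es].
by rewrite endpoint_rcons size_rcons target_level es IH.
Qed.

Lemma segment_target e0 s n : segment s -> (n.+1 < size s)%N ->
  target (nth e0 s n) = source (nth e0 s n.+1).
Proof.
move=> segs ns; move: segs; rewrite -{1}(cat_take_drop n s) segment_cat.
rewrite (drop_nth e0) ?(drop_nth e0 (n := n.+1))//; last exact: ltnW.
by move=> /andP[_ /= /andP[_ /andP[/eqP <- _]]].
Qed.

Section prefixes.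
Variable R : realType.
Implicit Types x y z : path_space R.

Lemma path_prefix x n :
  segment (mkseq x n) /\ endpoint (mkseq x n) = source (x n).
Proof.
elim: n => [|n [IHs IHe]]; first by rewrite /= path_root.
by rewrite mkseqS segment_rcons endpoint_rcons IHs IHe eqxx path_adj.
Qed.

Lemma segment_prefix x n : segment (mkseq x n).
Proof. by have [] := path_prefix x n. Qed.

Lemma endpoint_prefix x n : endpoint (mkseq x n) = source (x n).
Proof. by have [] := path_prefix x n. Qed.

Lemma path_level x n : ((source (x n)).1 + (source (x n)).2)%N = n.
Proof. by rewrite -endpoint_prefix endpoint_level ?segment_prefix ?size_mkseq. Qed.

Lemma cylinder_segment s x : cylinder s x -> segment s.
Proof. by rewrite /cylinder/= => <-; exact: segment_prefix. Qed.

Lemma cylinder_endpoint s x : cylinder s x -> endpoint s = source (x (size s)).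
Proof. by move=> {1}<-; rewrite endpoint_prefix. Qed.

(** The default edge of [nth] is never reached. *)
Definition splice (s : seq edge) (f : nat -> edge) (n : nat) : edge :=
  if (n < size s)%N then nth (axis_edge 0) s n else f n.

(** A total function: the value is x when s is not a segment that leads to the
    vertex of x at level [size s]. *)
Definition splice_path (s : seq edge) x : path_space R :=
  xget x [set y | forall n, y n = splice s x n].

Lemma splice_pathE s x : segment s -> endpoint s = source (x (size s)) ->
  forall n, splice_path s x n = splice s x n.
Proof.
move=> segs ends; rewrite /splice_path; case: xgetP => [y -> //|nex].
exfalso.
have h0 : source (splice s x 0) = Defs.root.
  rewrite /splice; case: s segs ends {nex} => [_ _|e s /andP[/eqP]//].
  exact: path_root.
have hS n : target (splice s x n) = source (splice s x n.+1).
  rewrite /splice; have [ns|sn|ns] := ltngtP n.+1 (size s).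
  - by rewrite segment_target.
  - by rewrite path_adj.
  rewrite ns -ends /endpoint (last_nth Defs.root).
  by rewrite size_map -ns /= (nth_map (axis_edge 0))// ns.
by apply: (nex (@PathSpace R _ h0 hS)).
Qed.

Lemma splice_prefix s (f : nat -> edge) n : (size s <= n)%N ->
  mkseq (splice s f) n = s ++ drop (size s) (mkseq f n).
Proof.
move=> sn; have e0 := axis_edge 0; apply: (@eq_from_nth _ e0).
  by rewrite size_cat size_drop !size_mkseq subnKC.
move=> i; rewrite size_mkseq => ilt; rewrite nth_mkseq// /splice nth_cat.
case: ltnP => si; first by apply: set_nth_default.
by rewrite nth_drop subnKC// nth_mkseq.
Qed.

Lemma splice_cylinder s x : cylinder s x -> splice s x = x :> (nat -> edge).
Proof.
move=> xs; apply/funext => n; rewrite /splice; case: ltnP => // ns.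
by rewrite -xs nth_mkseq.
Qed.

Lemma splice_ge s (f : nat -> edge) n : (size s <= n)%N -> splice s f n = f n.
Proof. by rewrite /splice ltnNge => ->. Qed.

Lemma path_splice y x n : (forall m, (n <= m)%N -> y m = x m) ->
  splice (mkseq y n) x = y :> (nat -> edge).
Proof.
move=> yx; apply/funext => m; rewrite /splice size_mkseq; case: ltnP => mn.
  by rewrite nth_mkseq.
by rewrite yx.
Qed.

End prefixes.

Section order.
Variables (le : rel edge) (hle : edge_order le).
Implicit Types f g h : nat -> edge.

(** [path_lt] for arbitrary sequences of edges, so that paths and finite
    segments, padded by a common tail, are compared by the same relation. *)
Definition seq_lt f g : Prop :=
  exists n, [/\ forall m, (n < m)%N -> f m = g m, f n != g n & le (f n) (g n)].

(** What makes [seq_lt] an order: edges that follow a last difference have the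
    same target, hence are compared by the order on the edges entering it. *)
Definition coherent f g : Prop :=
  forall n, (forall m, (n < m)%N -> f m = g m) -> target (f n) = target (g n).

Lemma seq_lt_irr f : ~ seq_lt f f.
Proof. by case=> n [_]; rewrite eqxx. Qed.

Lemma seq_lt_trans f g h : coherent f g -> coherent g h ->
  seq_lt f g -> seq_lt g h -> seq_lt f h.
Proof.
move=> cfg cgh [n [fg fgn len]] [m [gh ghm lem]].
have [nm|mn|nm] := ltngtP n m.
- exists m; split; rewrite ?fg// => k mk.
  by rewrite fg ?gh// (ltn_trans nm).
- exists n; split; rewrite -?gh// => k nk.
  by rewrite fg// gh// (ltn_trans mn).
subst m; exists n; split => [k nk||]; first by rewrite fg// gh.
  apply/eqP => efh; have [_ anti _ _] := hle (target (f n)).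
  move/eqP: fgn; apply; apply: anti; rewrite ?inE ?(cfg n)//.
  by rewrite len efh.
have [_ _ tr _] := hle (target (g n)).
by apply: (tr (g n)) => //; rewrite inE ?(cfg n)// (cgh n).
Qed.

Lemma seq_lt_asym f g : coherent f g -> coherent g f ->
  seq_lt f g -> ~ seq_lt g f.
Proof. by move=> fg gf fltg /(seq_lt_trans fg gf fltg)/seq_lt_irr. Qed.

Lemma seq_lt_total f g N : coherent f g ->
  (forall m, (N <= m)%N -> f m = g m) -> f <> g -> seq_lt f g \/ seq_lt g f.
Proof.
move=> cfg fgN neq.
have ex : exists n, f n != g n.
  apply/not_existsP => H; apply: neq; apply/funext => n.
  by apply/eqP/negPn/negP; exact: H.
have bd n : f n != g n -> (n <= N)%N.
  by move=> fgn; rewrite leqNgt; apply/negP => /ltnW/fgN/eqP; apply/negP.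
have [n fgn nmax] := ex_maxnP ex bd.
have fg m : (n < m)%N -> f m = g m.
  move=> nm; apply/eqP/negPn/negP => /nmax; apply/negP.
  by rewrite -ltnNge.
have [_ _ _ tot] := hle (target (f n)).
have fn : f n \in entering (target (f n)) by rewrite inE.
have gn : g n \in entering (target (f n)) by rewrite inE (cfg n).
have /orP[len|len] := tot _ _ fn gn.
- by left; exists n.
- by right; exists n; split; rewrite 1?eq_sym// => m /fg.
Qed.

(** The last difference lies in the initial segments, whatever the common tail. *)
Lemma seq_lt_splice s t f g : size s = size t ->
  seq_lt (splice s f) (splice t f) -> seq_lt (splice s g) (splice t g).
Proof.
move=> st [n [fg fgn len]].
have ns : (n < size s)%N.
  by rewrite ltnNge; apply/negP => sn; move: fgn; rewrite !splice_ge ?eqxx// -st.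
exists n; split; rewrite /splice -?st ?ns//.
- move=> m /fg; rewrite /splice -st; by case: ifP.
- by move: fgn; rewrite /splice -st ns.
- by move: len; rewrite /splice -st ns.
Qed.

(** The tail is irrelevant by [seq_lt_splice]. *)
Definition seg_lt s t : Prop :=
  seq_lt (splice s (fun=> axis_edge 0)) (splice t (fun=> axis_edge 0)).

Definition comparable s t : Prop :=
  [/\ segment s, segment t, size s = size t & endpoint s = endpoint t].

Lemma comparable_sym s t : comparable s t -> comparable t s.
Proof. by case. Qed.

Lemma comparable_trans s t u : comparable s t -> comparable t u -> comparable s u.
Proof. by move=> [s1 s2 st est] [_ s3 tu etu]; split; rewrite ?st ?est. Qed.

Lemma segment_coherent s t f : comparable s t ->
  coherent (splice s f) (splice t f).
Proof.
move=> [segs segt st est] n; rewrite /splice -st => H.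
have [ns|//] := ltnP n (size s).
have [nSs|sn] := ltnP n.+1 (size s).
  rewrite !segment_target -?st//; congr source.
  by have := H n.+1 (leqnn _); rewrite nSs.
have {}sn : size s = n.+1 by apply/eqP; rewrite eqn_leq sn ns.
move: est; rewrite /endpoint !(last_nth Defs.root) !size_map.
by rewrite -st sn /= !(nth_map (axis_edge 0)) -?st ?sn.
Qed.

Lemma seg_lt_trans s t u : comparable s t -> comparable t u ->
  seg_lt s t -> seg_lt t u -> seg_lt s u.
Proof. by move=> st tu; apply: seq_lt_trans; exact: segment_coherent. Qed.

Lemma seg_lt_total s t : comparable s t -> s <> t -> seg_lt s t \/ seg_lt t s.
Proof.
move=> st nst; apply: (@seq_lt_total _ _ (size s)).
- exact: segment_coherent.
- by case: st => _ _ st _ m sm; rewrite !splice_ge// -st.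
move=> eqst; apply: nst; case: st => _ _ st _.
have := splice_prefix (fun=> axis_edge 0) (leqnn (size s)).
rewrite eqst st splice_prefix// -st => /eqP.
by rewrite eqseq_cat// => /andP[/eqP].
Qed.

Definition immediate s t : Prop :=
  [/\ comparable s t, seg_lt s t &
      forall u, comparable s u -> seg_lt s u -> u = t \/ seg_lt t u].

End order.

(** * Immediate successors and the adic transformation *)

Definition outgoing (v : vertex) : finType := ('I_v.2.+1 + 'I_v.1.+1)%type.

Definition out_edge (v : vertex) (u : outgoing v) : edge :=
  Tagged (fun v : vertex => ('I_v.2.+1 + 'I_v.1.+1)%type) u.

(** A list of all segments of length n, which provides the finiteness behind
    immediate successors. *)
Fixpoint segments (n : nat) : seq (seq edge) :=
  if n is n'.+1 then
    flatten [seq [seq rcons s (out_edge u) | u <- enum (outgoing (endpoint s))]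
            | s <- segments n']
  else [:: [::]].

Lemma segments_complete s : segment s -> s \in segments (size s).
Proof.
elim/last_ind: s => // s e IH; rewrite segment_rcons size_rcons.
move=> /andP[/IH sin /eqP es]; apply/flatten_mapP; exists s => //.
case: e es => v u /= ev; rewrite /source/= in ev; subst v.
by apply/mapP; exists u; rewrite ?mem_enum.
Qed.

Lemma seq_least (T : eqType) (P : T -> Prop) (lt : T -> T -> Prop) (l : seq T) :
  (forall x y z, P x -> P y -> P z -> lt x y -> lt y z -> lt x z) ->
  (forall x y, P x -> P y -> x <> y -> lt x y \/ lt y x) ->
  (exists2 x, x \in l & P x) ->
  exists2 m, P m & forall u, u \in l -> P u -> u = m \/ lt m u.
Proof.
move=> tr tot; elim: l => [[]//|a l IH] [x xl Px].
have [/IH[m Pm mP]|nex] := pselect (exists2 x, x \in l & P x).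
  have [Pa|nPa] := pselect (P a); last first.
    by exists m => // u; rewrite inE => /predU1P[->//|]; exact: mP.
  have [eam|/eqP am] := eqVneq a m.
    by exists m => // u; rewrite inE => /predU1P[->|]; [left|exact: mP].
  have [ltam|ltma] := tot a m Pa Pm am.
    exists a => // u; rewrite inE => /predU1P[->|ul Pu]; first by left.
    right; have [->//|] := mP u ul Pu; exact: tr.
  by exists m => // u; rewrite inE => /predU1P[->|]; [right|exact: mP].
have xa : x = a.
  by move: xl; rewrite inE => /predU1P[//|xl]; case: nex; exists x.
subst x; exists a => // u; rewrite inE => /predU1P[->|ul Pu]; first by left.
by case: nex; exists u.
Qed.

Section successors.
Variables (le : rel edge) (hle : edge_order le).

Lemma immediate_successor s t : comparable s t -> seg_lt le s t ->
  exists u, immediate le s u.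
Proof.
move=> st lst.
have [|||m [sm lsm] mmin] := @seq_least _ (fun u => comparable s u /\ seg_lt le s u)
    (seg_lt le) (segments (size s)).
- move=> x y z [sx _] [sy _] [sz _]; apply: seg_lt_trans => //.
    exact: comparable_trans (comparable_sym sx) sy.
  exact: comparable_trans (comparable_sym sy) sz.
- move=> x y [sx _] [sy _]; apply: seg_lt_total => //.
  exact: comparable_trans (comparable_sym sx) sy.
- by exists t => //; case: st => _ segt -> _; exact: segments_complete.
exists m; split => // u su lsu; apply: mmin => //.
by case: su => _ segu -> _; exact: segments_complete.
Qed.

End successors.

(** Reversing the order exchanges successors and predecessors. *)
Lemma edge_order_flip le : edge_order le -> edge_order (fun e f => le f e).
Proof.
move=> hle v; have [rf anti tr tot] := hle v; split => //.
- by move=> x y xv yv; rewrite andbC; exact: anti.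
- by move=> x y z xv yv zv xy yz; exact: (tr x z y).
- by move=> x y xv yv; exact: tot.
Qed.

Lemma seq_lt_flip le f g :
  seq_lt (fun e e' => le e' e) f g <-> seq_lt le g f.
Proof.
by split=> -[n [fg fgn len]]; exists n; split; rewrite 1?eq_sym// => m /fg.
Qed.

Section predecessors.
Variables (le : rel edge) (hle : edge_order le).

Lemma immediate_predecessor s t : comparable s t -> seg_lt le s t ->
  exists u, immediate le u t.
Proof.
move=> st lst.
have [|u [tu ltu umax]] := immediate_successor (edge_order_flip hle)
  (comparable_sym st).
  by apply/seq_lt_flip.
have {}ltu : seg_lt le u t by apply/seq_lt_flip.
exists u; split => //; first exact: comparable_sym.
move=> r ur lur; have tr := comparable_trans tu ur.
have [->|/eqP tr'] := eqVneq r t; first by left.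
right; have [lrt|//] := seg_lt_total hle (comparable_sym tr) tr'.
have [|eru|/seq_lt_flip lru] := umax r tr; first by apply/seq_lt_flip.
  by move: lur; rewrite eru => /seq_lt_irr.
exfalso.
apply: (seq_lt_asym hle _ _ lur lru); apply: segment_coherent => //.
exact: comparable_sym.
Qed.

Variable R : realType.
Implicit Types x y z : path_space R.

Lemma path_coherent x y : coherent x y.
Proof. by move=> n H; rewrite !path_adj H. Qed.

Lemma path_lt_trans x y z : path_lt le x y -> path_lt le y z -> path_lt le x z.
Proof. by apply: seq_lt_trans => //; exact: path_coherent. Qed.

Lemma path_lt_irr x : ~ path_lt le x x.
Proof. exact: seq_lt_irr. Qed.

Lemma adicE x y : path_lt le x y ->
  (forall z, path_lt le x z -> z = y \/ path_lt le y z) -> adic le x = y.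
Proof.
move=> xy ymin; apply: xget_unique => // z [xz zmin].
have [//|yz] := ymin z xz; have [//|zy] := zmin y xy.
by have /path_lt_irr := path_lt_trans yz zy.
Qed.

Lemma path_lt_prefix x y : path_lt le x y -> exists s t,
  [/\ comparable s t, seg_lt le s t, cylinder s x & cylinder t y].
Proof.
move=> [n [xy xyn len]]; exists (mkseq x n.+1), (mkseq y n.+1).
split; try by rewrite /cylinder /mkset size_mkseq.
  by split; rewrite ?segment_prefix ?size_mkseq// !endpoint_prefix xy.
apply: (@seq_lt_splice _ _ _ x); rewrite ?size_mkseq//.
rewrite path_splice// path_splice; last by move=> m nm; rewrite xy.
by exists n.
Qed.

(** A path above x either agrees with x beyond s, and then its initial segment is
    above s, hence at least t; or differs from x later, and then it is also above
    the path obtained by replacing s by t. *)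
Lemma immediate_least s t x : immediate le s t -> cylinder s x ->
  path_lt le x (splice_path t x) /\
  forall z, path_lt le x z ->
    z = splice_path t x \/ path_lt le (splice_path t x) z.
Proof.
move=> [[segs segt st est] lst tmin] xs.
have tE : splice_path t x = splice t x :> (nat -> edge).
  by apply/funext => n; apply: splice_pathE; rewrite // -est -st -cylinder_endpoint.
split.
  have : seq_lt le (splice s x) (splice t x) by apply: seq_lt_splice lst.
  by rewrite splice_cylinder// -tE.
move=> z [n [xz xzn len]]; have [ns|sn] := ltnP n (size s).
  pose u := mkseq z (size s).
  have zE : splice u x = z.
    by apply: path_splice => m sm; rewrite xz// (leq_trans ns).
  have su : comparable s u.
    split=> //; rewrite ?segment_prefix ?size_mkseq// endpoint_prefix.
    by rewrite (cylinder_endpoint xs) xz.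
  have su_size : size s = size u by case: su.
  have lsu : seg_lt le s u.
    apply: (@seq_lt_splice _ _ _ x) => //.
    by rewrite splice_cylinder// zE; exists n.
  have [ut|ltu] := tmin u su lsu.
    by left; apply: path_space_eq => m; rewrite tE -ut zE.
  right; rewrite /path_lt -/(seq_lt _ _ _) tE -zE.
  by apply: seq_lt_splice ltu; rewrite -st.
right; exists n; rewrite tE splice_ge -?st//; split => // m nm.
by rewrite splice_ge -?st ?xz// (leq_trans sn)// ltnW.
Qed.

Lemma adic_immediate s t x : immediate le s t -> cylinder s x ->
  adic le x = splice_path t x.
Proof. by move=> st xs; have [] := immediate_least st xs; exact: adicE. Qed.

Lemma immediate_nonmax s t x : immediate le s t -> cylinder s x -> ~ Xmax le x.
Proof. by move=> st xs; have [xy _] := immediate_least st xs; move/(_ _ xy). Qed.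

Lemma nonmaxP x : ~ Xmax le x -> exists s t, immediate le s t /\ cylinder s x.
Proof.
move=> /existsNP[y /contrapT /path_lt_prefix[s [t [st lst xs _]]]].
by have [u su] := immediate_successor hle st lst; exists s, u.
Qed.

Lemma nonminP y : ~ Xmin le y -> exists s t, immediate le s t /\ cylinder t y.
Proof.
move=> /existsNP[x /contrapT /path_lt_prefix[s [t [st lst _ yt]]]].
by have [u ut] := immediate_predecessor st lst; exists u, t.
Qed.

Lemma adic_least x : ~ Xmax le x -> path_lt le x (adic le x) /\
  forall z, path_lt le x z -> z = adic le x \/ path_lt le (adic le x) z.
Proof.
move=> /nonmaxP[s [t [st xs]]].
by rewrite (adic_immediate st xs); exact: immediate_least st xs.
Qed.

(** If x < y had the same image, minimality of the image of x would place it at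
    or below y, hence strictly below the image of y. *)
Lemma adic_inj x y : ~ Xmax le x -> ~ Xmax le y -> adic le x = adic le y -> x = y.
Proof.
move=> /adic_least[xT xmin] /adic_least[yT ymin] eqT.
have [n [xz _ _]] := xT; have [m [yz _ _]] := yT.
apply: contrapT => xy.
have xy_tail k : (maxn n m < k)%N -> x k = y k.
  by rewrite gtn_max => /andP[nk mk]; rewrite xz// yz// eqT.
have nxy : path_edge x <> path_edge y.
  by move=> exy; apply: xy; apply: path_space_eq => k; rewrite exy.
have [|] := seq_lt_total hle (@path_coherent x y) xy_tail nxy.
  move=> /xmin[yE|Ty]; first by move: yT; rewrite -eqT -yE => /path_lt_irr.
  by move: Ty; rewrite eqT => Ty; have /path_lt_irr := path_lt_trans Ty yT.
move=> /ymin[xE|Tx]; first by move: xT; rewrite eqT -xE => /path_lt_irr.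
by move: Tx; rewrite -eqT => Tx; have /path_lt_irr := path_lt_trans Tx xT.
Qed.

Lemma splice_path_cylinder s t x : comparable s t -> cylinder s x ->
  cylinder t (splice_path t x) /\ splice_path s (splice_path t x) = x.
Proof.
move=> [segs segt st est] xs.
have tE : splice_path t x = splice t x :> (nat -> edge).
  by apply/funext => n; apply: splice_pathE; rewrite // -est -st -cylinder_endpoint.
split.
  by rewrite /cylinder/= tE splice_prefix// drop_oversize ?cats0 ?size_mkseq.
apply: path_space_eq => n; rewrite splice_pathE//; last first.
  by rewrite tE splice_ge -?st// (cylinder_endpoint xs).
rewrite /splice; case: ltnP => sn; first by rewrite -xs nth_mkseq.
by rewrite tE splice_ge// -st.
Qed.

Lemma adic_cylinder s t : immediate le s t ->
  adic le @` cylinder s = @cylinder R t.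
Proof.
move=> st; have [cst _ _] := st; apply/seteqP; split => [_ [x xs <-]|y yt].
  by rewrite (adic_immediate st xs); have [] := splice_path_cylinder cst xs.
have [xs xy] := splice_path_cylinder (comparable_sym cst) yt.
by exists (splice_path s y); rewrite // (adic_immediate st xs).
Qed.

Lemma adic_surj y : ~ Xmin le y -> exists2 x, ~ Xmax le x & adic le x = y.
Proof.
move=> /nonminP[s [t [st]]]; rewrite -(adic_cylinder st) => -[x xs <-].
by exists x => //; exact: immediate_nonmax st xs.
Qed.

(** A path and its image have the same edges from some level on. *)
Lemma tail_invariant_set (B : set (path_space R)) :
  (forall x y n, (forall m, (n <= m)%N -> x m = y m) -> B x -> B y) ->
  adic_invariant_set le B.
Proof.
move=> tailB; apply/seteqP; split => [_ [x [Bx xmax] <-]|y [By ymin]].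
  have [xT _] := adic_least xmax; split; last by move/(_ _ xT).
  by have [n [xz _ _]] := xT; apply: tailB Bx => m /xz.
have [x xmax xy] := adic_surj ymin; exists x => //; split => //.
have [xT _] := adic_least xmax; have [n [xz _ _]] := xT.
by apply: (tailB y x n.+1) => // m nm; rewrite -xy xz.
Qed.

Lemma adic_cylinderI s t B : adic_invariant_set le B -> immediate le s t ->
  adic le @` (cylinder s `&` B) = @cylinder R t `&` B.
Proof.
move=> TB st; apply/seteqP; split => [_ [x [xs Bx] <-]|y [yt By]].
  split; first by rewrite -(adic_cylinder st); exists x.
  suff [] : (B `\` Xmin le) (adic le x) by [].
  by rewrite -TB; exists x => //; split => //; exact: immediate_nonmax st xs.
move: (yt); rewrite -(adic_cylinder st) => -[x xs xy].
have xmax := immediate_nonmax st xs; have [xT _] := adic_least xmax.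
have : (B `\` Xmin le) y by split => //; rewrite -xy => /(_ _ xT).
rewrite -TB => -[z [Bz zmax] zy].
have xz : x = z by apply: adic_inj; rewrite // zy.
by exists x => //; split; rewrite // xz.
Qed.

(** Otherwise take the least t above s that is not related to s: its immediate
    predecessor is s itself or lies above s, hence is related to s. *)
Lemma comparable_ind (P : seq edge -> seq edge -> Prop) :
  (forall s, P s s) -> (forall s t, P s t -> P t s) ->
  (forall s t u, P s t -> P t u -> P s u) ->
  (forall s t, immediate le s t -> P s t) ->
  forall s t, comparable s t -> P s t.
Proof.
move=> Prefl Psym Ptrans Pimm.
suff Plt s t : comparable s t -> seg_lt le s t -> P s t.
  move=> s t st; have [->|/eqP nst] := eqVneq s t; first exact: Prefl.
  have [/Plt|/Plt ts] := seg_lt_total hle st nst; first by apply.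
  exact/Psym/ts/comparable_sym.
move=> st lst; apply: contrapT => nP.
pose bad u := [/\ comparable s u, seg_lt le s u & ~ P s u].
have [|||m [sm lsm nPm] mmin] := @seq_least _ bad (seg_lt le) (segments (size s)).
- move=> x y z [sx _ _] [sy _ _] [sz _ _]; apply: seg_lt_trans => //.
    exact: comparable_trans (comparable_sym sx) sy.
  exact: comparable_trans (comparable_sym sy) sz.
- move=> x y [sx _ _] [sy _ _]; apply: seg_lt_total => //.
  exact: comparable_trans (comparable_sym sx) sy.
- by exists t => //; case: st => _ segt -> _; exact: segments_complete.
have [p pm] := immediate_predecessor sm lsm; have [cpm lpm pmin] := pm.
have sp : comparable s p := comparable_trans sm (comparable_sym cpm).
have asym u v : comparable u v -> seg_lt le u v -> ~ seg_lt le v u.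
  move=> uv; apply: seq_lt_asym => //; first exact: segment_coherent.
  exact/segment_coherent/comparable_sym.
have irr u : ~ seg_lt le u u by exact: seq_lt_irr.
have [esp|/eqP nsp] := eqVneq s p; first by apply: nPm; rewrite esp; exact: Pimm.
have [lsp|lps] := seg_lt_total hle sp nsp; last first.
  have [esm|lms] := pmin s (comparable_sym sp) lps.
    by move: lsm; rewrite esm => /irr.
  exact: asym sm lsm lms.
have Psp : P s p.
  apply: contrapT => nPp; have [||epm|lmp] := mmin p.
  - by case: sp => _ segp -> _; exact: segments_complete.
  - by split.
  - by move: lpm; rewrite epm => /irr.
  - exact: asym cpm lpm lmp.
exact/nPm/(Ptrans _ _ _ Psp)/Pimm.
Qed.

End predecessors.

(** * Cylinders and Borel sets *)

Section borel.
Variable R : realType.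
Local Notation X := (path_space R).

Lemma cylinder_prefix (x : X) n : cylinder (mkseq x n) x.
Proof. by rewrite /cylinder/= size_mkseq. Qed.

Lemma take_prefix (f : nat -> edge) m n : (m <= n)%N ->
  take m (mkseq f n) = mkseq f m.
Proof.
move=> mn; apply: (@eq_from_nth _ (axis_edge 0)).
  by rewrite size_takel ?size_mkseq.
move=> i; rewrite size_takel ?size_mkseq// => im.
by rewrite nth_take// !nth_mkseq// (leq_trans im).
Qed.

Lemma cylinder_agree s (x y : X) : cylinder s x -> cylinder s y ->
  forall i, (i < size s)%N -> x i = y i.
Proof.
move=> xs ys i si.
rewrite -(nth_mkseq (axis_edge 0) x si) -(nth_mkseq (axis_edge 0) y si).
by rewrite xs ys.
Qed.

Lemma agree_cylinder s (x y : X) : cylinder s x ->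
  (forall i, (i < size s)%N -> x i = y i) -> cylinder s y.
Proof.
move=> xs xy; rewrite /cylinder/= -[RHS]xs; apply: (@eq_from_nth _ (axis_edge 0)).
  by rewrite !size_mkseq.
by move=> i; rewrite size_mkseq => si; rewrite !nth_mkseq// xy.
Qed.

Lemma cylinder_meet s t (x : X) : cylinder s x -> cylinder t x ->
  (size s <= size t)%N -> @cylinder R s `&` cylinder t = cylinder t.
Proof.
move=> xs xt st; apply/setIidPr => y yt; apply: (agree_cylinder xs) => i si.
by apply: (cylinder_agree xt yt); rewrite (leq_trans si).
Qed.

Lemma cylinder_open s : open (@cylinder R s).
Proof.
rewrite openE => x xs; apply/nbhs_ballP; exists (2 ^- size s).
  by rewrite /= invr_gt0 exprn_gt0.
move=> y; rewrite ballEmdist /= => /path_dist_ltP xy.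
by apply: (agree_cylinder xs) => i /ltnW; exact: xy.
Qed.

(** The lower bound N on the length allows measures to be compared on long
    cylinders only. *)
Lemma open_cylinder N (U : set X) x : open U -> U x ->
  exists s, [/\ (N <= size s)%N, cylinder s x & cylinder s `<=` U].
Proof.
rewrite openE => Uo /Uo /nbhs_ballP[e e0 eU].
have [n _ /(_ n (leqnn _)) ne] := near_infty_natSinv_expn_lt (PosNum e0).
exists (mkseq x (n.+1 + N)); split; first by rewrite size_mkseq leq_addl.
  exact: cylinder_prefix.
move=> y xy; apply: eU; rewrite ballEmdist /=.
rewrite (lt_trans _ ne)// mul1r; apply/path_dist_ltP => i ni.
apply: (cylinder_agree (cylinder_prefix _ _) xy).
by rewrite size_mkseq ltn_addr.
Qed.

(** The empty set makes the family closed under intersection. *)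
Definition long_cylinders N : set (set X) :=
  [set C | C = set0 \/ exists2 s, (N <= size s)%N & C = cylinder s].

Lemma cylinder_measurable s : measurable (@cylinder R s).
Proof. by apply: sub_sigma_algebra; exact: cylinder_open. Qed.

Lemma borel_long_cylinders N :
  (measurable : set (set X)) = <<s long_cylinders N >>.
Proof.
apply/seteqP; split; last first.
  apply: smallest_sub; first exact: sigma_algebra_measurable.
  by move=> C [->|[s _ ->]]; [exact: measurable0|exact: cylinder_measurable].
apply: smallest_sub; first exact: smallest_sigma_algebra.
move=> U Uo.
pose F (k : nat) : set X := if unpickle k is Some s then
  if asbool ((N <= size s)%N /\ @cylinder R s `<=` U) then cylinder s else set0
  else set0.
have -> : U = \bigcup_k F k.
  apply/seteqP; split => [x Ux|x [k _]]; last first.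
    by rewrite /F; case: unpickle => //= s; case: asboolP => // -[_]; exact.
  have [s [Ns xs sU]] := open_cylinder N Uo Ux.
  by exists (pickle s) => //; rewrite /F pickleK; case: asboolP => // -[].
have [_ _] := @smallest_sigma_algebra X setT (long_cylinders N); apply => k.
apply: sub_sigma_algebra; rewrite /F; case: unpickle => [s|]; last by left.
by case: asboolP => [[Ns _]|_]; [right; exists s|left].
Qed.

Lemma long_cylindersI N : setI_closed (long_cylinders N).
Proof.
move=> A B [->|[s Ns ->]]; first by rewrite set0I; left.
move=> [->|[t Nt ->]]; first by rewrite setI0; left.
have [[x [xs xt]]|nex] := pselect (cylinder s `&` @cylinder R t !=set0).
  have [st|/ltnW ts] := leqP (size s) (size t).
    by right; exists t; rewrite // (cylinder_meet xs xt).
  by right; exists s; rewrite // setIC (cylinder_meet xt xs).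
left; apply/seteqP; split => // x xst; case: nex; by exists x.
Qed.

Lemma eq_measure_cylinders N (m1 m2 : {measure set X -> \bar R}) :
  (m1 setT < +oo)%E ->
  (forall s, (N <= size s)%N -> segment s ->
    m1 (cylinder s) = m2 (cylinder s)) ->
  forall B, measurable B -> m1 B = m2 B.
Proof.
move=> m1oo m12.
pose g (k : nat) : set X := if unpickle k is Some s then
  if (N <= size s)%N then cylinder s else set0 else set0.
apply: (measure_unique (long_cylinders N) g).
- exact: borel_long_cylinders.
- exact: long_cylindersI.
- move=> k; rewrite /g; case: unpickle => [s|]; last by left.
  by case: ifP => Ns; [right; exists s|left].
- apply/seteqP; split => // x _; exists (pickle (mkseq x N)) => //.
  by rewrite /g pickleK size_mkseq leqnn; exact: cylinder_prefix.
- move=> _ [->|[s Ns ->]]; first by rewrite !measure0.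
  have [/m12 ->//|nsegs] := boolP (segment s).
  rewrite (_ : cylinder s = set0) ?measure0//; apply/seteqP; split => // x.
  by move/cylinder_segment; apply/negP.
- move=> k; apply: le_lt_trans m1oo; apply: le_measure; rewrite ?inE//.
  rewrite /g; case: unpickle => [s|//]; case: ifP => // _.
  exact: cylinder_measurable.
Qed.

End borel.

(** * Exchanging initial segments *)

Definition swap_seq (s t r : seq edge) : seq edge :=
  if take (size s) r == s then t ++ drop (size s) r
  else if take (size s) r == t then s ++ drop (size s) r else r.

Section swap.
Variables (R : realType) (s t : seq edge) (st : comparable s t).
Local Notation X := (path_space R).

(** An involution of the whole path space that acts on the cylinder of s as the
    adic transformation when t is the immediate successor of s.  Being total
    and measurable, it transports measures. *)
Definition swap_path (x : X) : X :=
  if mkseq x (size s) == s then splice_path t x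
  else if mkseq x (size s) == t then splice_path s x else x.

Let szst : size t = size s. Proof. by case: st. Qed.

Lemma splice_path_prefix a b (x : X) n : comparable a b -> cylinder a x ->
  (size a <= n)%N ->
  mkseq (splice_path b x) n = b ++ drop (size a) (mkseq x n).
Proof.
move=> [sega segb ab eab] xa an.
have -> : path_edge (splice_path b x) = splice b x.
  by apply/funext => m; apply: splice_pathE; rewrite // -eab -ab -cylinder_endpoint.
by rewrite splice_prefix -ab.
Qed.

Lemma swap_prefix x n : (size s <= n)%N ->
  mkseq (swap_path x) n = swap_seq s t (mkseq x n).
Proof.
move=> sn; rewrite /swap_path /swap_seq take_prefix//.
case: eqP => xs; first exact: splice_path_prefix.
case: eqP => xt//; rewrite -szst; apply: splice_path_prefix.
- exact: comparable_sym.
- by rewrite /cylinder/= szst.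
- by rewrite szst.
Qed.

Lemma swap_seqK r : (size s <= size r)%N -> swap_seq s t (swap_seq s t r) = r.
Proof.
move=> sr; rewrite {2}/swap_seq; case: eqP => [rs|rs].
  rewrite /swap_seq -szst take_size_cat// drop_size_cat// szst eqxx.
  case: eqP => [->|_]; last by rewrite -{1}rs cat_take_drop.
  by rewrite -{1}rs cat_take_drop.
case: eqP => [rt|rt]; last first.
  by rewrite /swap_seq; case: eqP => //; case: eqP.
by rewrite /swap_seq take_size_cat// drop_size_cat// eqxx -{1}rt cat_take_drop.
Qed.

Lemma size_swap_seq r : (size s <= size r)%N -> size (swap_seq s t r) = size r.
Proof.
move=> sr; rewrite /swap_seq; case: eqP => _; last case: eqP => _ //.
  by rewrite size_cat szst size_drop subnKC.
by rewrite size_cat size_drop subnKC.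
Qed.

Lemma swap_seq_comparable r : (size s <= size r)%N -> segment r ->
  comparable r (swap_seq s t r).
Proof.
move=> sr segr; split => //; last first.
- case: st => _ _ _ est; rewrite /swap_seq; case: eqP => [rs|_].
    by rewrite -{1}(cat_take_drop (size s) r) rs !endpoint_cat est.
  case: eqP => [rt|//].
  by rewrite -{1}(cat_take_drop (size s) r) rt !endpoint_cat est.
- by rewrite size_swap_seq.
case: st => segs segt _ est; rewrite /swap_seq; case: eqP => [rs|_].
  move: segr; rewrite -{1}(cat_take_drop (size s) r) rs !segment_cat est segt.
  by case/andP.
case: eqP => [rt|//].
move: segr; rewrite -{1}(cat_take_drop (size s) r) rt !segment_cat est segs.
by case/andP.
Qed.

Lemma swap_preimage r : (size s <= size r)%N ->
  swap_path @^-1` (cylinder r) = cylinder (swap_seq s t r).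
Proof.
move=> sr; apply/seteqP; split => x /=; rewrite /cylinder/= swap_prefix//.
  by rewrite size_swap_seq// => {2}<-; rewrite swap_seqK// size_mkseq.
by rewrite size_swap_seq// => ->; rewrite swap_seqK.
Qed.

Lemma swap_measurable : measurable_fun setT swap_path.
Proof.
apply: (measurability (@long_cylinders R (size s))).
  exact: borel_long_cylinders.
move=> _ [C [->|[r sr ->]] <-]; rewrite setTI ?preimage_set0//.
by rewrite swap_preimage//; exact: cylinder_measurable.
Qed.

Lemma swap_pathK x : swap_path (swap_path x) = x.
Proof.
apply: path_space_eq => n; pose N := (size s + n.+1)%N.
have nN : (n < N)%N by rewrite /N; lia.
have sN : (size s <= N)%N by rewrite leq_addr.
rewrite -(nth_mkseq (axis_edge 0) _ nN) -[RHS](nth_mkseq (axis_edge 0) _ nN).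
by rewrite !swap_prefix// swap_seqK// size_mkseq.
Qed.

Lemma swap_measure (mu : probability X R) :
  (forall a b, comparable a b -> mu (cylinder a) = mu (cylinder b)) ->
  forall B, measurable B -> mu (swap_path @^-1` B) = mu B.
Proof.
move=> central.
pose f : {mfun X >-> X} := mfun_Sub (mem_set swap_measurable).
apply: (@eq_measure_cylinders R (size s) (distribution mu f) mu).
  by rewrite /= /distribution /pushforward preimage_setT probability_setT ltry.
move=> r sr segr; rewrite /distribution/= /pushforward.
rewrite -[LHS]/(mu (swap_path @^-1` cylinder r)) swap_preimage//.
by apply: central; apply: comparable_sym; exact: swap_seq_comparable.
Qed.

End swap.

(** * Central measures are invariant *)

Section central.
Variables (R : realType) (le : rel edge) (hle : edge_order le).
Local Notation X := (path_space R).

(** For B = setT, this is centrality of mu; in general, of its restriction to B. *)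
Definition central (mu : set X -> \bar R) (B : set X) : Prop :=
  forall s t, comparable s t -> mu (cylinder s `&` B) = mu (cylinder t `&` B).

Lemma adic_image_swap s t (E : set X) : immediate le s t ->
  E `<=` cylinder s -> adic le @` E = swap_path s t @^-1` E.
Proof.
move=> st Es; have [cst _ _] := st.
have adicS (x : X) : cylinder s x -> adic le x = swap_path s t x.
  move=> xs; rewrite (adic_immediate hle st xs) /swap_path.
  by case: eqP.
apply/seteqP; split => [_ [x Ex <-]|y Ey] /=.
  by rewrite adicS ?swap_pathK//; exact: Es.
by exists (swap_path s t y) => //; rewrite adicS ?swap_pathK//; exact: Es.
Qed.

(** Cut a set of nonmaximal paths into countably many disjoint pieces, each in
    the cylinder of a segment with an immediate successor.  On each piece the
    transformation is an exchange of segments, which preserves mu; injectivity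
    keeps the images disjoint. *)
Lemma central_invariant (mu : probability X R) : central mu setT ->
  adic_invariant_measure le mu.
Proof.
move=> cmu B mB Bmax.
have {}cmu a b : comparable a b -> mu (cylinder a) = mu (cylinder b).
  by move=> /cmu; rewrite !setIT.
pose F (k : nat) : set X := if unpickle k is Some s then
  if `[< exists t, immediate le s t >] then B `&` cylinder s else set0 else set0.
have BF : B = \bigcup_k F k.
  apply/seteqP; split => [x Bx|x [k _]]; last first.
    by rewrite /F; case: unpickle => //= s; case: asboolP => // _ [].
  have [s [t [st xs]]] := nonmaxP hle (Bmax x Bx).
  by exists (pickle s) => //; rewrite /F pickleK; case: asboolP => // -[]; exists t.
have FD k : seqDU F k = set0 \/ exists s t,
    immediate le s t /\ seqDU F k `<=` cylinder s.
  have sub : seqDU F k `<=` F k by move=> x [].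
  rewrite [X in _ `<=` X]/F in sub; case: unpickle sub => [s|]; last first.
    by left; apply/seteqP; split.
  case: asboolP => [[t st] sub|_ sub]; last by left; apply/seteqP; split.
  by right; exists s, t; split => // x /sub[].
have mF k : measurable (seqDU F k).
  apply: seqDU_measurable => {}k; rewrite /F; case: unpickle => [s|//].
  by case: ifP => // _; apply: measurableI => //; exact: cylinder_measurable.
have TF k : measurable (adic le @` seqDU F k) /\
    mu (adic le @` seqDU F k) = mu (seqDU F k).
  have [->|[s [t [st sub]]]] := FD k; first by rewrite image_set0.
  have [cst _ _] := st; rewrite (adic_image_swap st sub); split.
    by rewrite -[X in measurable X]setTI; apply: swap_measurable.
  exact: swap_measure.
have Ttriv : trivIset setT (fun k => adic le @` seqDU F k).
  apply/trivIsetP => i j _ _ ij.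
  apply/seteqP; split => // z [[x xi <-] [y yj eT]].
  have nmax k w : seqDU F k w -> ~ Xmax le w.
    by move=> kw; apply: Bmax; rewrite BF seqDU_bigcup_eq; exists k.
  have exy : y = x by apply: (adic_inj hle (nmax _ _ yj) (nmax _ _ xi)).
  subst y; have /trivIsetP/(_ i j I I ij) := trivIset_seqDU F.
  by move/seteqP => -[+ _] => /(_ x); apply.
rewrite BF seqDU_bigcup_eq image_bigcup.
rewrite (measure_bigcup mu _ _ _ Ttriv); last by move=> k _; have [] := TF k.
rewrite (measure_bigcup mu _ _ _ (trivIset_seqDU F))//.
by apply: eq_eseriesr => k _; have [] := TF k.
Qed.

Lemma invariant_central (mu : probability X R) (B : set X) :
  adic_invariant_measure le mu -> measurable B ->
  (forall s t, immediate le s t ->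
    adic le @` (cylinder s `&` B) = cylinder t `&` B) ->
  central mu B.
Proof.
move=> Tmu mB TB; apply: (comparable_ind hle) => [//|s t ->//|s t u -> ->//|].
move=> s t st; rewrite -(TB s t st) Tmu//.
  by apply: measurableI => //; exact: cylinder_measurable.
by move=> x [xs _]; exact: immediate_nonmax st xs.
Qed.

End central.

(** * Central measures are determined by their mass away from the axes *)

Section weights.
Variable R : realType.
Local Notation X := (path_space R).

(** The paths through w; the level of w is w.1 + w.2. *)
Definition passing (w : vertex) : set X :=
  [set x | source (x (w.1 + w.2)%N) = w].

Lemma prefix_open (U : set X) :
  (forall x, U x -> exists n, @cylinder R (mkseq x n) `<=` U) -> open U.
Proof.
move=> HU.
have -> : U = \bigcup_(s in [set s | @cylinder R s `<=` U]) cylinder s.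
  apply/seteqP; split => [x Ux|x [s sU xs]]; last exact: sU.
  by have [n nU] := HU x Ux; exists (mkseq x n) => //; exact: cylinder_prefix.
by apply: bigcup_open => s _; exact: cylinder_open.
Qed.

Lemma passing_measurable w : measurable (passing w).
Proof.
apply: sub_sigma_algebra; apply: prefix_open => x xw.
exists (w.1 + w.2).+1 => y xy; rewrite /passing/= -[RHS]xw.
congr source; apply/esym; apply: (cylinder_agree (cylinder_prefix x _) xy).
by rewrite size_mkseq.
Qed.

Lemma segment_out s (u : outgoing (endpoint s)) : segment s ->
  segment (rcons s (out_edge u)).
Proof. by move=> segs; rewrite segment_rcons segs /= eqxx. Qed.

Lemma segment_to v : exists s, segment s && (endpoint s == v).
Proof.
case: v => i j; elim: i => [|i [s /andP[segs /eqP ends]]].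
  elim: j => [|j [s /andP[segs /eqP ends]]]; first by exists [::].
  exists (rcons s (@out_edge (endpoint s) (inr ord0))).
  by rewrite segment_out//= endpoint_rcons /target /= ends.
exists (rcons s (@out_edge (endpoint s) (inl ord0))).
by rewrite segment_out//= endpoint_rcons /target /= ends.
Qed.

Lemma comparable_endpoint s t : segment s -> segment t ->
  endpoint s = endpoint t -> comparable s t.
Proof. by move=> segs segt est; split => //; rewrite -!endpoint_level// est. Qed.

Lemma measure_split (mu : probability X R) s (E : set X) :
  measurable E -> segment s ->
  fine (mu (cylinder s `&` E)) =
  \sum_(u : outgoing (endpoint s)) fine (mu (cylinder (rcons s (out_edge u)) `&` E)).
Proof.
move=> mE segs.
have mC t : measurable (cylinder t `&` E).
  by apply: measurableI => //; exact: cylinder_measurable.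
rewrite sum_fine => [|u _]; last exact: fin_num_measure.
congr fine.
have -> : cylinder s `&` E = \bigcup_(u in [set` enum (outgoing (endpoint s))])
    (cylinder (rcons s (out_edge u)) `&` E).
  apply/seteqP; split => [x [xs Ex]|x [u _ [xu Ex]]]; last first.
    split=> //; move: xu; rewrite /cylinder/= size_rcons mkseqS.
    by move/eqP; rewrite eqseq_rcons => /andP[/eqP].
  have := cylinder_endpoint xs.
  case xsE: (x (size s)) => [v u] /= ev.
  rewrite /source/= in ev; subst v.
  exists u; first by rewrite /= mem_enum.
  by split => //; rewrite /cylinder/= size_rcons mkseqS xs xsE.
rewrite measure_fin_bigcup//.
- by rewrite -(fsbig_seq (idx := 0%E))/= ?enum_uniq// big_enum.
- apply/trivIsetP => u v _ _ uv; apply/seteqP; split => // x [[xu _] [xv _]].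
  move: xu xv; rewrite /cylinder/= !size_rcons => -> /eqP.
  by rewrite eqseq_rcons eq_Tagged/= (negbTE uv) andbF.
Qed.

Section central_weights.
Variables (mu : probability X R) (B : set X).
Hypotheses (mB : measurable B) (cmu : central mu B).

(** The chosen segment to (a, b) is immaterial by [weightE]. *)
Definition weight (a b : nat) : R :=
  fine (mu (cylinder (xchoose (segment_to (a, b))) `&` B)).

Lemma weight_ge0 a b : 0 <= weight a b.
Proof. exact: fine_ge0. Qed.

Lemma weightE s : segment s -> 
  fine (mu (cylinder s `&` B)) = weight (endpoint s).1 (endpoint s).2.
Proof.
move=> segs; rewrite /weight -surjective_pairing.
have /andP[segt /eqP ends] := xchooseP (segment_to (endpoint s)).
by congr fine; apply: cmu; apply: comparable_endpoint.
Qed.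

Lemma weight_harmonic : harmonic weight.
Proof.
move=> a b; have [s /andP[segs /eqP ends]] := segment_to (a, b).
have := weightE segs; rewrite ends/= => <-; rewrite measure_split//.
under eq_bigr => u _ do rewrite weightE ?segment_out// endpoint_rcons.
rewrite big_sumType/= /target/= ends !sumr_const !card_ord.
by rewrite !mulr_natl.
Qed.

(** By backward induction from the level of w: extending s by one edge obeys the
    recursion of [path_count]. *)
Lemma weight_passing w k s : segment s -> (size s + k = w.1 + w.2)%N ->
  fine (mu (cylinder s `&` (B `&` passing w))) =
  (path_count w k (endpoint s).1 (endpoint s).2)%:R * weight w.1 w.2.
Proof.
have mBw : measurable (B `&` passing w).
  by apply: measurableI => //; exact: passing_measurable.
elim: k s => [|k IH] s segs sk.
  rewrite addn0 in sk; rewrite /= -surjective_pairing.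
  have [sw|sw] := eqVneq (endpoint s) w.
    rewrite mul1r -sw -weightE//; congr (fine (mu _)).
    apply/seteqP; split => [x [xs [Bx _]]|x [xs Bx]]; split => //; split => //.
    by rewrite /passing/= sw -sk -(cylinder_endpoint xs) sw.
  rewrite mul0r (_ : _ `&` _ = set0) ?measure0//.
  apply/seteqP; split => // x [xs [_]]; rewrite /passing/= -sk.
  by rewrite -(cylinder_endpoint xs) => /eqP; apply/negP.
rewrite measure_split//.
under eq_bigr => u _ do
  rewrite IH ?segment_out ?size_rcons -?sk ?addnS// endpoint_rcons.
rewrite big_sumType/= /target/= !sumr_const !card_ord natrD !natrM mulrDl.
by rewrite -!mulrA !mulr_natl.
Qed.

Lemma passing_bound w :
  (path_count w (w.1 + w.2) 0 0)%:R * weight w.1 w.2 <= fine (mu (passing w)).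
Proof.
have mw := passing_measurable w.
have mBw : measurable (B `&` passing w) by apply: measurableI.
have mC : measurable (cylinder [::] `&` (B `&` passing w)).
  by apply: measurableI => //; exact: cylinder_measurable.
rewrite -(@weight_passing w _ [::])//.
apply: fine_le; [exact: fin_num_measure|exact: fin_num_measure|].
by apply: le_measure; rewrite ?inE// => x [_ []].
Qed.

(** The mass of the vertices near the axes for the restriction of mu to B is at
    most that for mu, so [harmonic_uniform] applies to the weight of the
    restriction, whose value at the root is the mass of B. *)
Lemma central_uniform :
  (forall i, fine (mu (passing (i, j))) @[j --> \oo] --> (0 : R)) ->
  (forall j, fine (mu (passing (i, j))) @[i --> \oo] --> (0 : R)) ->
  forall s, segment s ->
    mu (cylinder s `&` B) = (((size s).+1`!%:R^-1)%:E * mu B)%E.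
Proof.
move=> lim1 lim2 s segs.
have mCB t : measurable (cylinder t `&` B).
  by apply: measurableI => //; exact: cylinder_measurable.
have sq i j : 0 <= (path_count (i, j) (i + j) 0 0)%:R * weight i j <=
    fine (mu (passing (i, j))).
  by rewrite mulr_ge0 ?weight_ge0//=; exact: (passing_bound (i, j)).
have w0 : weight 0 0 = fine (mu B).
  have := @weightE [::] isT => /= <-; congr (fine (mu _)).
  by apply/seteqP; split => [x []|x Bx].
rewrite -[LHS]fineK ?fin_num_measure// weightE//.
rewrite (harmonic_uniform weight_harmonic weight_ge0) ?endpoint_level//.
- by rewrite w0 EFinM fineK// fin_num_measure.
- move=> i; apply: (squeeze_cvgr _ (cvg_cst 0) (lim1 i)).
  by near=> j.
- move=> j; apply: (squeeze_cvgr _ (cvg_cst 0) (lim2 j)).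
  by near=> i.
Unshelve. all: by end_near. Qed.

End central_weights.

End weights.

(** * Existence of the symmetric measure *)

(** The position of e among the v.1 + v.2 + 2 edges leaving its source v. *)
Definition edge_rank (e : edge) : nat :=
  match tagged e with inl k => k | inr k => (source e).2.+1 + k end.

Definition nth_edge (v : vertex) (d : nat) : edge :=
  if (d <= v.2)%N then @out_edge v (inl (inord d))
  else @out_edge v (inr (inord (d - v.2.+1))).

Lemma source_nth_edge v d : source (nth_edge v d) = v.
Proof. by rewrite /nth_edge; case: ifP. Qed.

Lemma edge_rank_lt e : (edge_rank e < ((source e).1 + (source e).2).+2)%N.
Proof.
case: e => v [k|k]; rewrite /edge_rank /source /=; have := ltn_ord k; lia.
Qed.

Lemma nth_edge_rank e : nth_edge (source e) (edge_rank e) = e.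
Proof.
case: e => v [k|k]; rewrite /nth_edge /edge_rank /source /=.
  by rewrite -ltnS ltn_ord inord_val.
by rewrite leqNgt ltnS leq_addr/= addKn inord_val.
Qed.

Lemma rank_nth_edge v d : (d < (v.1 + v.2).+2)%N ->
  edge_rank (nth_edge v d) = d.
Proof.
move=> dv; rewrite /nth_edge; case: leqP => vd; rewrite /edge_rank /source /=.
  by rewrite inordK.
by rewrite inordK; lia.
Qed.

Section existence.
Variable R : realType.
Local Notation X := (path_space R).

(** Replacing the reals outside of [0, 1) by 0 makes the coding below a measurable
    function on all reals, with the same bounds everywhere. *)
Definition unit_part (x : R) : R := x * \1_(`[0, 1[%classic : set R) x.

Lemma unit_partE x : x \in `[0, 1[ -> unit_part x = x.
Proof. by move=> x01; rewrite /unit_part indicE mem_set ?mulr1. Qed.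

Lemma unit_part_itv x : 0 <= unit_part x < 1.
Proof.
rewrite /unit_part indicE; case: (boolP (x \in _)) => [|_].
  by rewrite inE/= in_itv/= mulr1.
by rewrite mulr0 lexx ltr01.
Qed.

(** The first n digits of the expansion of x in the factorial base, packed in one
    integer below (n + 1)!. *)
Definition code (n : nat) (x : R) : nat :=
  Num.truncn ((n.+1)`!%:R * unit_part x).

Definition digit n x : nat := (code n.+1 x %% n.+2)%N.

Lemma truncn_div (y : R) n : 0 <= y ->
  (Num.truncn (n.+1%:R * y) %/ n.+1)%N = Num.truncn y.
Proof.
move=> y0; apply/esym/truncn_def.
have := @truncn_itv R _ (mulr_ge0 (ler0n R n.+1) y0).
move: (Num.truncn _) => m /andP[my ym]; apply/andP; split.
  rewrite -(ler_pM2l (ltr0Sn R n)) (le_trans _ my)// -natrM ler_nat mulnC.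
  exact: leq_trunc_div.
rewrite -(ltr_pM2l (ltr0Sn R n)) (lt_le_trans ym)// -natrM ler_nat.
by rewrite mulnC; exact: ltn_ceil.
Qed.

Lemma codeS n x : code n.+1 x = (code n x * n.+2 + digit n x)%N.
Proof.
rewrite {1}(divn_eq (code n.+1 x) n.+2); congr (_ * _ + _)%N.
rewrite /code factS natrM -mulrA truncn_div// mulr_ge0//.
by have /andP[] := unit_part_itv x.
Qed.

Fixpoint coded_vertex (x : R) (n : nat) : vertex :=
  if n is n'.+1 then target (nth_edge (coded_vertex x n') (digit n' x))
  else Defs.root.

Definition coded_path (x : R) : X :=
  @PathSpace R (fun n => nth_edge (coded_vertex x n) (digit n x))
    (source_nth_edge _ _) (fun n => esym (source_nth_edge _ _)).

(** The first n digits of x determine and are determined by the first n edges of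
    its path, as the digit of rank k ranges over the k + 2 edges leaving a vertex
    of level k. *)
Lemma coded_cylinder s : segment s ->
  exists2 N, (N < (size s).+1`!)%N &
    forall x, cylinder s (coded_path x) <-> code (size s) x = N.
Proof.
elim/last_ind: s => [_|s e IH].
  exists 0%N => // x; split=> // _; rewrite /code mul1r.
  by apply: truncn_def; exact: unit_part_itv.
rewrite segment_rcons size_rcons => /andP[segs /eqP es].
have [N NS NP] := IH segs.
have re : (edge_rank e < (size s).+2)%N.
  by have := edge_rank_lt e; rewrite es endpoint_level.
exists (N * (size s).+2 + edge_rank e)%N.
  rewrite [in ltnRHS]factS [ltnRHS]mulnC; apply: (@leq_trans (N.+1 * (size s).+2)).
    by rewrite mulSn [ltnRHS]addnC ltn_add2l.
  by rewrite leq_mul2r NS orbT.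
move=> x; rewrite codeS.
have dlt : (digit (size s) x < (size s).+2)%N by rewrite ltn_mod.
have cylE : cylinder (rcons s e) (coded_path x) <->
    cylinder s (coded_path x) /\ coded_path x (size s) = e.
  rewrite /cylinder/= size_rcons mkseqS; split=> [/eqP|[-> ->//]].
  by rewrite eqseq_rcons => /andP[/eqP -> /eqP ->].
rewrite cylE; split=> [[xs xe]|/(congr1 (fun m => (m %/ (size s).+2, m %% (size s).+2)%N))].
  congr (_ * _ + _)%N; first exact/NP.
  rewrite -xe /= rank_nth_edge//.
  have := path_level (coded_path x) (size s).
  by rewrite /= source_nth_edge => ->.
rewrite !divnMDl// !modnMDl !divn_small// !addn0 !modn_small// => -[/NP xs de].
split=> //=; rewrite de.
have -> : coded_vertex x (size s) = source e.
  by rewrite es (cylinder_endpoint xs) /= source_nth_edge.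
exact: nth_edge_rank.
Qed.

Lemma unit_part_measurable : measurable_fun setT unit_part.
Proof.
apply: measurable_funM; first exact: measurable_id.
exact: measurable_indic.
Qed.

Lemma coded_path_measurable : measurable_fun setT coded_path.
Proof.
apply: (measurability (@long_cylinders R 0)).
  exact: borel_long_cylinders.
move=> _ [C [->|[s _ ->]] <-]; rewrite setTI ?preimage_set0//.
have [segs|nsegs] := boolP (segment s); last first.
  rewrite (_ : cylinder s = set0) ?preimage_set0//.
  by apply/seteqP; split => // x /cylinder_segment; exact/negP.
have [N _ NP] := coded_cylinder segs.
have -> : coded_path @^-1` (cylinder s) =
    (fun x => (size s).+1`!%:R * unit_part x) @^-1` `[N%:R, N.+1%:R[%classic.
  apply/seteqP; split => x /=; rewrite in_itv/=.
    move/NP => <-; apply: truncn_itv; rewrite mulr_ge0//.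
    by have /andP[] := unit_part_itv x.
  by move=> H; apply/NP; exact: truncn_def.
rewrite -[X in measurable X]setTI.
have mcu : measurable_fun setT (fun x => (size s).+1`!%:R * unit_part x).
  by apply: measurable_funM; [exact: measurable_cst|exact: unit_part_measurable].
by apply: mcu => //; exact: measurable_itv.
Qed.

Definition unit_measure : set (measurableTypeR R) -> \bar R :=
  mrestr (@lebesgue_measure R) (measurable_itv `[0%R, 1%R[).

HB.instance Definition _ := Measure.on unit_measure.

Lemma unit_measure_setT : unit_measure setT = 1%E.
Proof.
rewrite /unit_measure /mrestr setTI.
by have := lebesgue_measure_itv `[0%R, 1%R[ => -> /=; rewrite lte_fin ltr01 oppr0 adde0.
Qed.

HB.instance Definition _ := Measure_isProbability.Build _ _ _ unit_measure
  unit_measure_setT.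

(** By [coded_cylinder], the preimage of a cylinder of length n in [0, 1) is an
    interval of length 1 / (n + 1)!. *)
Lemma exists_symmetric_measure :
  exists eta : probability X R, forall s, segment s ->
    eta (cylinder s) = ((size s).+1`!%:R^-1)%:E.
Proof.
pose f : {mfun measurableTypeR R >-> X} :=
  @mfun_Sub _ _ (measurableTypeR R) X _ (mem_set coded_path_measurable).
exists (distribution unit_measure f) => s segs.
rewrite -[LHS]/(lebesgue_measure (coded_path @^-1` cylinder s `&` `[0%R, 1%R[%classic)).
have [N NS NP] := coded_cylinder segs.
set c : R := (size s).+1`!%:R.
have c0 : 0 < c by rewrite ltr0n fact_gt0.
have -> : coded_path @^-1` cylinder s `&` `[0%R, 1%R[%classic =
    [set` `[N%:R / c, N.+1%:R / c[].
  apply/seteqP; split => x /=; rewrite !in_itv/= ler_pdivrMr// ltr_pdivlMr//.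
    move=> [/NP xN x01]; rewrite ![x * c]mulrC.
    have : 0 <= c * unit_part x.
      by rewrite mulr_ge0 ?(ltW c0)//; have /andP[] := unit_part_itv x.
    by move/truncn_itv; rewrite -[Num.truncn _]/(code (size s) x) xN unit_partE.
  rewrite ![x * c]mulrC => /andP[Nx xN].
  have x0 : 0 <= x by rewrite -(pmulr_rge0 _ c0) (le_trans _ Nx).
  have x1 : x < 1.
    rewrite -(ltr_pM2l c0) mulr1 (lt_le_trans xN)// ler_nat.
    exact: NS.
  have x01 : 0 <= x < 1 by rewrite x0.
  split=> //; apply/NP; rewrite /code unit_partE ?in_itv//.
  by apply: truncn_def; rewrite -/c Nx.
have := lebesgue_measure_itv `[N%:R / c, N.+1%:R / c[ => -> /=.
rewrite lte_fin ltr_pM2r ?invr_gt0// ltr_nat ltnSn -EFinB; congr EFin.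
by rewrite -mulrBl -natrB// subSnn mul1r.
Qed.

End existence.

(** * Properties of the symmetric measure *)

Section symmetric.
Variables (R : realType) (eta : probability (path_space R) R).
Local Notation X := (path_space R).

(** A segment of length n has n + 2 one-edge extensions, of equal mass. *)
Lemma symmetric_cylinder : symmetric_measure eta ->
  forall s, segment s -> eta (cylinder s) = ((size s).+1`!%:R^-1)%:E.
Proof.
move=> sym; elim/last_ind => [_|s e IH].
  rewrite /= invr1 -(@probability_setT _ _ _ eta); congr (eta _).
  by apply/seteqP; split.
move=> segse; have := segse; rewrite segment_rcons => /andP[segs /eqP es].
have E t : fine (eta (cylinder t `&` setT)) = fine (eta (cylinder t)).
  by rewrite setIT.
have mC t : measurable (@cylinder R t) by exact: cylinder_measurable.
have := measure_split eta measurableT segs; rewrite E IH//=.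
under eq_bigr => u _.
  rewrite E (sym (size s).+1 _ (cylinder (rcons s e))); first over.
    exists (rcons s (out_edge u)).
    by rewrite segment_out// size_rcons.
  by exists (rcons s e); rewrite size_rcons.
rewrite sumr_const cardT -cardE card_sum !card_ord addSn addnS.
rewrite addnC endpoint_level// => H.
rewrite -[LHS]fineK ?fin_num_measure//; congr EFin.
by rewrite size_rcons [in RHS]factS natrM invfM H -[X in _ * X]mulr_natl mulKf.
Qed.

Lemma symmetric_central : symmetric_measure eta -> central eta setT.
Proof.
move=> sym s t [segs segt st _]; rewrite !setIT.
by apply: (sym (size s)); [exists s|exists t].
Qed.

Lemma symmetric_passing w : symmetric_measure eta ->
  fine (eta (@passing R w)) =
  (path_count w (w.1 + w.2) 0 0)%:R / (w.1 + w.2).+1`!%:R.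
Proof.
move=> sym; have cen := symmetric_central sym.
have -> : @passing R w = cylinder [::] `&` (setT `&` @passing R w).
  by apply/seteqP; split => [x|x [_ []]].
rewrite (weight_passing measurableT cen (k := w.1 + w.2))//; congr (_ * _).
have [s /andP[segs /eqP ends]] := segment_to w.
rewrite -ends -(weightE cen segs) setIT symmetric_cylinder//=.
by rewrite endpoint_level.
Qed.

Lemma symmetric_avoids_axes : symmetric_measure eta ->
  (forall i, fine (eta (@passing R (i, j))) @[j --> \oo] --> (0 : R)) /\
  (forall j, fine (eta (@passing R (i, j))) @[i --> \oo] --> (0 : R)).
Proof.
move=> sym; split=> k; under eq_fun do rewrite symmetric_passing//=.
  exact: path_count_negligible.
by under eq_fun do rewrite path_count_sym addnC; exact: path_count_negligible.
Qed.

Lemma symmetric_fully_supported : symmetric_measure eta -> fully_supported eta.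
Proof.
move=> sym U Uo [x Ux]; have [s [_ xs sU]] := open_cylinder 0 Uo Ux.
apply: (@lt_le_trans _ _ (eta (cylinder s))).
  by rewrite symmetric_cylinder ?(cylinder_segment xs)// lte_fin invr_gt0 ltr0n fact_gt0.
apply: le_measure; rewrite ?inE//; first exact: cylinder_measurable.
exact: sub_sigma_algebra.
Qed.

End symmetric.

(** * Ergodic measures of full support leave the axes *)

Section escape.
Variables (R : realType) (le : rel edge) (hle : edge_order le).
Local Notation X := (path_space R).
Variable mu : probability X R.
Hypotheses (mu_full : fully_supported mu) (mu_erg : ergodic le mu).

Section coordinate.
Variable c : vertex -> nat.
Hypothesis c_mono : forall e, (c (source e) <= c (target e))%N.
Hypothesis c_climbs : exists x : X, forall n, c (source (x n)) = n.

(** The letter c stands for either coordinate. *)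
Definition low (K n : nat) : set X := [set x | (c (source (x n)) <= K)%N].

Lemma coordinate_mono (x : X) m n : (m <= n)%N ->
  (c (source (x m)) <= c (source (x n)))%N.
Proof.
move=> /subnKC <-; elim: (n - m)%N => [|k IH]; first by rewrite addn0.
by rewrite addnS -path_adj (leq_trans IH).
Qed.

Lemma low_measurable K n : measurable (low K n).
Proof.
apply: sub_sigma_algebra; apply: prefix_open => x xK.
exists n.+1 => y xy; rewrite /low/= (_ : y n = x n)//.
by apply/esym; apply: (cylinder_agree (cylinder_prefix x _) xy); rewrite size_mkseq.
Qed.

(** The coordinate is nondecreasing along a path, so staying below K for ever
    depends on the tail of the path only; ergodicity leaves the masses 0 and 1,
    and full support excludes 1 since some path climbs above K. *)
Lemma forever_low_null K : mu (\bigcap_n low K n) = 0%E.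
Proof.
have mL : measurable (\bigcap_n low K n).
  by apply: bigcapT_measurable => n; exact: low_measurable.
have inv : adic_invariant_set le (\bigcap_n low K n).
  apply: (tail_invariant_set hle) => x y n xy xL m _.
  apply: leq_trans (coordinate_mono y (leq_maxl m n)) _.
  by rewrite -xy ?leq_maxr//; exact: xL.
have [//|mu1] := mu_erg mL inv.
have : (0 < mu (~` \bigcap_n low K n))%E.
  apply: mu_full; last first.
    have [x xc] := c_climbs; exists x => /(_ K.+1 I).
    by rewrite /low/= xc ltnn.
  apply: prefix_open => x /existsNP[n /not_implyP[_ xn]]; exists n.+1 => y xy yL.
  apply: xn; have := yL n I; rewrite /low/= (_ : y n = x n)//.
  by apply/esym; apply: (cylinder_agree (cylinder_prefix x _) xy); rewrite size_mkseq.
by rewrite probability_setC// mu1 subee// ltxx.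
Qed.

Lemma low_vanishes K : fine (mu (low K n)) @[n --> \oo] --> (0 : R).
Proof.
have H : mu (low K n) @[n --> \oo] --> mu (\bigcap_n low K n).
  apply: nonincreasing_cvg_mu.
  - by rewrite (le_lt_trans (probability_le1 _ _)) ?ltry//; exact: low_measurable.
  - exact: low_measurable.
  - by apply: bigcapT_measurable => n; exact: low_measurable.
  - move=> m n mn; apply/subsetPset => x; rewrite /low/= => xn.
    exact: leq_trans (coordinate_mono x mn) xn.
by rewrite forever_low_null in H; exact: (fine_cvg H).
Qed.

Lemma passing_low w K : (c w <= K)%N ->
  0 <= fine (mu (@passing R w)) <= fine (mu (low K (w.1 + w.2))).
Proof.
move=> wK; have mp := @passing_measurable R w; have ml := low_measurable K (w.1 + w.2).
rewrite fine_ge0//= fine_le ?fin_num_measure//.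
by apply: le_measure; rewrite ?inE// => x xw; rewrite /low/= xw.
Qed.

End coordinate.

Lemma source_target_le e : ((source e).1 <= (target e).1)%N /\
  ((source e).2 <= (target e).2)%N.
Proof. by case: e => v [u|u]; rewrite /target /source/=. Qed.

Lemma ergodic_avoids_axes :
  (forall i, fine (mu (@passing R (i, j))) @[j --> \oo] --> (0 : R)) /\
  (forall j, fine (mu (@passing R (i, j))) @[i --> \oo] --> (0 : R)).
Proof.
split=> k.
- have x1 : exists x : X, forall n, (source (x n)).1 = n.
    by exists (axis_path R).
  have m1 e := (source_target_le e).1.
  have lim := low_vanishes m1 x1 k.
  rewrite -(cvg_shiftn k) in lim.
  apply: (squeeze_cvgr _ (cvg_cst 0) lim); near=> j.
  by rewrite /= addnC; exact: (@passing_low (fun w => w.1) (k, j)).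
- pose x : X := @PathSpace R
    (fun n => @out_edge (0%N, n) (inr ord0)) erefl (fun=> erefl).
  have x2 : exists x : X, forall n, (source (x n)).2 = n by exists x.
  have m2 e := (source_target_le e).2.
  have lim := low_vanishes m2 x2 k.
  rewrite -(cvg_shiftn k) in lim.
  apply: (squeeze_cvgr _ (cvg_cst 0) lim); near=> i.
  by rewrite /=; exact: (@passing_low (fun w => w.2) (i, k)).
Unshelve. all: by end_near. Qed.

End escape.

(** * Unique ergodicity *)

Section conclusion.
Variables (R : realType) (le : rel edge) (hle : edge_order le).
Local Notation X := (path_space R).

(** By [central_uniform] on B, the measures C |-> eta (C `&` B) and eta B * eta
    agree on cylinders, hence at B itself: eta B is its own square. *)
Lemma symmetric_ergodic (eta : probability X R) : symmetric_measure eta ->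
  adic_invariant_measure le eta -> ergodic le eta.
Proof.
move=> sym Teta B mB TB.
have cB : central eta B.
  by apply: (invariant_central hle) => // s t; exact: adic_cylinderI.
have [lim1 lim2] := symmetric_avoids_axes sym.
have b0 : 0 <= fine (eta B) by exact: fine_ge0.
have key : mrestr eta mB B = mscale (NngNum b0) eta B.
  apply: (@eq_measure_cylinders R 0 (mrestr eta mB) (mscale (NngNum b0) eta)).
  - rewrite -[X in (X < _)%E]/(eta (setT `&` B)) setTI.
    by rewrite (le_lt_trans (probability_le1 _ mB))// ltry.
  - move=> s _ segs; rewrite -[LHS]/(eta (cylinder s `&` B)).
    rewrite -[RHS]/((fine (eta B))%:E * eta (cylinder s))%E.
    rewrite (central_uniform mB cB lim1 lim2)// (symmetric_cylinder sym)//.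
    by rewrite muleC fineK// fin_num_measure.
  - exact: mB.
move: key; rewrite /mrestr /mscale /= setIid.
rewrite -[eta B]fineK ?fin_num_measure//= -EFinM => -[] /eqP.
rewrite -{1}[fine _]mulr1 -subr_eq0 -mulrBr mulf_eq0 subr_eq0 => /orP[] /eqP H.
  by left; rewrite H.
by right; rewrite -H.
Qed.

Lemma ergodic_cylinder (mu : probability X R) :
  fully_supported mu -> adic_invariant_measure le mu -> ergodic le mu ->
  forall s, segment s -> mu (cylinder s) = ((size s).+1`!%:R^-1)%:E.
Proof.
move=> full inv erg s segs.
have [lim1 lim2] := ergodic_avoids_axes hle full erg.
have cen : central mu setT.
  apply: (invariant_central hle inv) => // a b ab.
  by rewrite !setIT; exact: adic_cylinder.
have := central_uniform measurableT cen lim1 lim2 segs.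
by rewrite setIT probability_setT mule1.
Qed.

End conclusion.

Theorem mainTheorem2 (R : realType) (le : rel edge) (hle : edge_order le) :
  (exists eta : probability (path_space R) R,
    [/\ symmetric_measure eta,
        forall nu : probability (path_space R) R,
          symmetric_measure nu -> same_measure nu eta,
        [/\ fully_supported eta, adic_invariant_measure le eta & ergodic le eta] &
        forall mu : probability (path_space R) R,
          fully_supported mu -> adic_invariant_measure le mu -> ergodic le mu ->
          same_measure mu eta]) /\
  (forall mu : probability (path_space R) R,
    fully_supported mu -> adic_invariant_measure le mu -> ergodic le mu ->
    forall (n : nat) (C : set (path_space R)), is_cylinder n C ->
      mu C = ((n.+1)`!%:R^-1)%:E).
Proof.
have sameP (mu nu : probability (path_space R) R) :
    (forall s, segment s -> mu (cylinder s) = nu (cylinder s)) ->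
    same_measure mu nu.
  by move=> H B; apply: (@eq_measure_cylinders R 0) => // [|s _];
    [rewrite -[X in (X < _)%E]/(mu setT) probability_setT ltry|exact: H].
split; last first.
  by move=> mu full inv erg n C [s [segs <- ->]]; exact: (ergodic_cylinder hle).
have [eta etaC] := exists_symmetric_measure R.
have sym : symmetric_measure eta.
  by move=> n C D [s [segs sn ->]] [t [segt tn ->]]; rewrite !etaC// sn tn.
have inv := central_invariant hle (symmetric_central sym).
exists eta; split => //.
- by move=> nu nusym; apply: sameP => s segs; rewrite etaC// symmetric_cylinder.
- split=> //; first exact: symmetric_fully_supported.
  exact: symmetric_ergodic.
move=> mu full muinv erg; apply: sameP => s segs.
by rewrite etaC// (ergodic_cylinder hle).
Qed.
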